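(* Assume that $g_i(x)=\mu_i e^{-\mu_i x}$ ($x\ge 0$) for $i=1,2$, i.e. Willie's and Alice's service times are exponential with rates $\mu_1$ and $\mu_2$, and that Alice uses the IEBP policy with insertion probability $q=q(n)$ satisfying $\lim_{n\to\infty}q(n)=0$. Let $T(n)=nq(n)$. Alice can be covert if $$T(n)=\begin{cases}\mathcal O(\sqrt n), & \mu_1<2\mu_2,\\ \mathcal O(\sqrt{n/\log n}), & \mu_1=2\mu_2,\\ \mathcal O(n^{\mu_2/\mu_1}), & \mu_1>2\mu_2.\end{cases}$$ She cannot be covert if $$T(n)=\begin{cases}\omega(\sqrt n), & \mu_1<2\mu_2,\\ \omega(\sqrt{n/\log n}), & \mu_1=2\mu_2,\\ \omega(n^{\mu_2/\mu_1}), & \mu_1>2\mu_2.\end{cases}$$ (The meaning of ''can be covert'' and ''cannot be covert'' is given in the context.)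
   Context: Model. Willie's jobs arrive according to a Poisson process of rate $\lambda\in(0,\infty)$ to a single-server FIFO queue, empty at time $0$. Willie's service times are iid with density $g_1$ and mean $1/\mu_1$; Alice's service times are iid with density $g_2$ and mean $1/\mu_2$; service times and arrivals are mutually independent; $\lambda/\mu_1<1$. Alice's jobs cannot be preempted once in service. Let $A_i,D_i$ be the arrival and departure times of Willie's $i$-th job, $D_0=0$. The reconstructed service times are $S_1=D_1-A_1$ and $S_i=D_i-\max\{A_i,D_{i-1}\}$ for $i\ge2$. A Willie Busy Period (W-BP) is the time interval from the arrival of a Willie job finding no other Willie job in the system to the first subsequent departure of a Willie job leaving no other Willie job in the system. Let $M_0=0$, $M_j=\min\{i>M_{j-1}:A_{i+1}>D_i\}$. IEBP policy with parameter $q\in[0,1]$: at the end of each W-BP (time $0$ being treated as such an end), Alice independently inserts one job with probability $q$, and otherwise inserts none until the end of the next W-BP. $H_0$: Alice inserts no jobs ($q=0$). $H_1$: Alice uses IEBP with $q=q(n)$, where $n$ is the number of W-BPs observed by Willie. $T(n)=nq(n)$ is the expected number of jobs Alice inserts in $n$ W-BPs. Let $Y_j=S_{M_{j-1}+1}$ (reconstructed service time of the first Willie job in the $j$-th W-BP) and $V_j=A_{M_{j-1}+1}-D_{M_{j-1}}$ (preceding idle period). Under either hypothesis the pairs $(Y_j,V_j)$, $j=1,\dots,n$, are iid; $f_i$ denotes their common density under $H_i$. Under $H_0$, $f_0(y,v)=g_1(y)\lambda e^{-\lambda v}$. Under $H_1$, $(Y,V)$ is distributed as $(\sigma_1+\mathbf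 1_A(\sigma_2-V)^+,V)$ with $\sigma_1\sim g_1$, $\sigma_2\sim g_2$, $V$ exponential with rate $\lambda$ and $P(A)=q$, all independent. $f^{\otimes n}$ is the $n$-fold tensor product density, and $T_V(u_0,u_1)=\frac12\int|u_0-u_1|$. Willie uses an optimal test on $(Y_{1:n},V_{1:n})$, for which the minimum of (false alarm probability + missed detection probability) is $P_E^\star=1-T_V(f_0^{\otimes n},f_1^{\otimes n})$. Covertness. Alice's insertions are covert if for any $\epsilon>0$ she has an insertion strategy $(q(n))_n$ such that $\liminf_n P_E^\star\ge 1-\epsilon$, equivalently $\limsup_n T_V(f_0^{\otimes n},f_1^{\otimes n})\le\epsilon$. Explicitly: ''Alice can be covert if $T(n)=\mathcal O(b_n)$'' means that for every $\phi:\{1,2,\dots\}\to[1,\infty)$ with $n/\phi(n)=\mathcal O(b_n)$ and every $\epsilon>0$ there is $\delta\in(0,1]$ such that with $q(n)=\delta/\phi(n)$ (so $T(n)=\delta n/\phi(n)$) one has $\limsup_nT_V(f_0^{\otimes n},f_1^{\otimes n})\le\epsilon$. ''Alice cannot be covert if $T(n)=\omega(b_n)$'' means that there is $\epsilon_0>0$ such that every admissible sequence $q(n)\in[0,1]$ (here with $q(n)\to0$) with $nq(n)/b_n\to\infty$ satisfies $\limsup_nT_V(f_0^{\otimes n},f_1^{\otimes n})>\epsilon_0$. *)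

(* Defs.v *)
From HB Require Import structures.
From mathcomp Require Import all_boot all_order all_algebra.
From mathcomp Require Import all_classical all_reals all_analysis.
Import Order.TTheory GRing.Theory Num.Theory.
Import numFieldNormedType.Exports.

Set Implicit Arguments.
Unset Strict Implicit.
Unset Printing Implicit Defensive.

Local Open Scope classical_set_scope.
Local Open Scope ring_scope.

(** ** Sample paths of the queue under IEBP

    Indices are shifted by one: [tau i], [s1 i] are the interarrival time and
    the service time of Willie's job number [i.+1].  The pair [b i], [s2 i] is
    only used when a W-BP ends with the departure of job [i] ([i = 0] being time
    [0]): then Alice inserts a job iff [b i] holds, and its service time is
    [s2 i].  *)

Section queue.
Context {R : realType}.
Variables (tau s1 s2 : nat -> R) (b : nat -> bool).

(** Arrival time of Willie's [i]-th job, [i >= 1]; [arrival 0 = 0]. *)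
Definition arrival (i : nat) : R := \sum_(k < i) tau k.

(** Departure time of Willie's [i]-th job, [departure 0 = 0].  If job [i] ends a
    W-BP, a job of Alice inserted then finds an idle server, so it occupies it
    from [D_i] to [D_i + s2 i] and cannot be preempted.  Otherwise job [i.+1]
    is already waiting at [D_i] and enters service at once. *)
Fixpoint departure (i : nat) : R :=
  match i with
  | 0 => 0
  | j.+1 =>
      (if (j == 0)%N || (departure j < arrival j.+1)
       then Num.max (arrival j.+1) (departure j + (if b j then s2 j else 0))
       else departure j) + s1 j
  end.

(** [reconstructed i] is S_i, for [i >= 1]. *)
Definition reconstructed (i : nat) : R :=
  if i == 1%N then departure 1 - arrival 1
  else departure i - Num.max (arrival i) (departure i.-1).

(** [next_end m = min {i > m : A_{i+1} > D_i}]; the value when this set is empty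
    (a null event for a stable queue) is arbitrary. *)
Definition next_end (m : nat) : nat :=
  match pselect (exists i, (m < i)%N && (departure i < arrival i.+1)) with
  | left h => ex_minn h
  | right _ => 0%N
  end.

(** [wbp_end j] is M_j. *)
Definition wbp_end (j : nat) : nat := iter j next_end 0%N.

(** [observation j] is the pair (Y_{j+1}, V_{j+1}). *)
Definition observation (j : nat) : R * R :=
  (reconstructed (wbp_end j).+1,
   arrival (wbp_end j).+1 - departure (wbp_end j)).

End queue.

(** ** The probabilistic model *)

Section model.
Context {d : measure_display} {Omega : measurableType d} {R : realType}.
Variable P : probability Omega R.

Definition mutually_independent (I : eqType) (F : I -> set (set Omega)) : Prop :=
  forall (s : seq I) (E : I -> set Omega), uniq s ->
    (forall i, i \in s -> F i (E i)) ->
    P (\big[setI/setT]_(i <- s) E i) = (\prod_(i <- s) P (E i))%E.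

(** The sigma-algebra generated by a random variable. *)
Definition sigma_of {d' : measure_display} {T : measurableType d'}
    (X : Omega -> T) : set (set Omega) :=
  preimage_set_system setT X measurable.

Definition exponential_law (rate : R) (X : Omega -> R) : Prop :=
  forall B : set R, measurable B -> P (X @^-1` B) = exponential_prob rate B.

Section iebp.
Variables (tau s1 s2 : nat -> {mfun Omega >-> R}).
Variable b : nat -> {mfun Omega >-> bool}.

Definition iebp_inputs (i : (nat + nat) + (nat + nat)) : set (set Omega) :=
  match i with
  | inl (inl k) => sigma_of (tau k)
  | inl (inr k) => sigma_of (s1 k)
  | inr (inl k) => sigma_of (s2 k)
  | inr (inr k) => sigma_of (b k)
  end.

(** Poisson arrivals with rate [lambda] (iid exponential interarrival times),
    exponential services with rates [mu1] (Willie) and [mu2] (Alice), and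
    insertion probability [q]. *)
Record iebp_model (lambda mu1 mu2 q : R) : Prop := {
  iebp_independent : mutually_independent iebp_inputs;
  iebp_interarrival : forall k, exponential_law lambda (tau k);
  iebp_service1 : forall k, exponential_law mu1 (s1 k);
  iebp_service2 : forall k, exponential_law mu2 (s2 k);
  iebp_insertion : forall k, P (b k @^-1` [set true]) = q%:E
}.

Definition iebp_observation (j : nat) (w : Omega) : R * R :=
  observation (tau ^~ w) (s1 ^~ w) (s2 ^~ w) (b ^~ w) j.

End iebp.

(** [f] is a density, with respect to the measure [mu], of the law of [X]. *)
Definition has_density {d' : measure_display} {T : measurableType d'}
    (mu : set T -> \bar R) (X : Omega -> T) (f : T -> R) : Prop :=
  [/\ measurable_fun setT f, (forall x, 0 <= f x) &
      forall B, measurable B -> P (X @^-1` B) = (\int[mu]_(x in B) (f x)%:E)%E].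

End model.

(** ** Total variation between tensor products of densities *)

Section total_variation.
Context {d : measure_display} {T : measurableType d} {R : realType}.
Local Open Scope ereal_scope.

(** The [n]-fold product of [mu]. *)
Fixpoint tuple_measure (mu : set T -> \bar R) (n : nat) :
    set (n.-tuple T) -> \bar R :=
  match n with
  | 0 => dirac [tuple]
  | m.+1 => pushforward (mu \x @tuple_measure mu m)
              (fun p : T * m.-tuple T => [tuple of p.1 :: p.2])
  end.

Definition tensor (f : T -> R) (n : nat) (t : n.-tuple T) : R :=
  (\prod_(i < n) f (tnth t i))%R.

Definition TV (mu : set T -> \bar R) (u0 u1 : T -> R) : \bar R :=
  (2^-1)%:E * \int[mu]_x `|u0 x - u1 x|%:E.

End total_variation.

(** ** Covertness *)

Section covertness.
Context {R : realType}.

Definition lebesgue2 : set (R * R) -> \bar R :=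
  (@lebesgue_measure R \x @lebesgue_measure R)%E.

(** [f q] is the density of one pair (Y, V) under insertion probability [q], so
    the hypothesis H_0 corresponds to [f 0] and H_1 to [f (q n)]. *)
Variable f : R -> R * R -> R.

Definition TV_iebp (q : nat -> R) (n : nat) : \bar R :=
  TV (tuple_measure lebesgue2 (n := n))
    (tensor (f 0) (n := n)) (tensor (f (q n)) (n := n)).

Definition can_be_covert (bn : nat -> R) : Prop :=
  forall phi : nat -> R, (forall n, (0 < n)%N -> 1 <= phi n) ->
    (fun n => n%:R / phi n : R^o) =O_\oo (bn : nat -> R^o) ->
    forall eps : R, 0 < eps -> exists2 delta : R, 0 < delta <= 1 &
      (limn_esup (TV_iebp (fun n => (delta / phi n)%R)) <= eps%:E)%E.

(** [n%:R * q n] is T(n), the expected number of insertions. *)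
Definition cannot_be_covert (bn : nat -> R) : Prop :=
  exists2 eps0 : R, 0 < eps0 &
    forall q : nat -> R, (forall n, (0 < n)%N -> 0 <= q n <= 1) ->
      q @ \oo --> 0 ->
      (fun n => n%:R * q n / bn n) @ \oo --> +oo ->
      (eps0%:E < limn_esup (TV_iebp q))%E.

(** Only the values for large [n] matter ([n / ln n] is the junk value [0] at
    [n = 1]). *)
Definition covert_scale (mu1 mu2 : R) (n : nat) : R :=
  if mu1 < 2 * mu2 then Num.sqrt n%:R
  else if mu1 == 2 * mu2 then Num.sqrt (n%:R / ln n%:R)
  else n%:R `^ (mu2 / mu1).

End covertness.

(* Main.v *)
From HB Require Import structures.
Require Import Defs.
From mathcomp Require Import all_boot all_order all_algebra.
From mathcomp Require Import all_classical all_reals all_analysis.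
From mathcomp Require Import measurable_realfun ring lra.
Import Order.TTheory GRing.Theory Num.Theory.
Import numFieldNormedType.Exports.

(** An inserted job delays the first Willie job of the next busy period by
    (sigma2 - V)^+, and by lack of memory this delay is, with probability
    exp (- mu2 V), a fresh exponential of rate mu2 and 0 otherwise.  Hence (Y, V) has the density f_q = f_0 (1 + q Z) with
    Z (y, v) = exp (- mu2 v) (r y - 1), where
    r y = mu2 \int_0^y exp (a s) ds, a = mu1 - mu2, is the ratio of the density of
    sigma1 + sigma2 to that of sigma1 ([iebp_observation_law], [density_aeE]).

    The total variation between the n-fold products is controlled by the affinity
    rho = \int sqrt (f_0 f_q), which is multiplicative:
    1 - rho ^ n <= TV <= ((1 - rho ^ n) / c + 2 c) / 2 for every c > 0
    ([TV_tensor_ge], [TV_tensor_le]).  So the question is the size of n (1 - rho),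
    and 2 (1 - rho) = \int f_0 (sqrt (1 + q Z) - 1) ^ 2.

    Under f_0, Z grows like exp (a y) while y has the tail exp (- mu1 y), so Z is
    square integrable iff 2 a < mu1, that is mu1 < 2 mu2.  This is the source of
    the three regimes.  Cut y at L = ln n / mu1, the level that a single
    observation exceeds with probability 1 / n.  Since
    (sqrt (1 + x) - 1) ^ 2 <= min (x ^ 2, |x|), the upper bound uses the second
    moment of Z below L and its first moment above L ([affinity_ge]); at
    q = b_n / n, with b_n the claimed scale, both contribute O (1 / n)
    ([covert_rate_upper]).  Thus q = kappa b_n / n gives n (1 - rho) = O (kappa),
    which delta makes small.  For the converse it suffices to find a rectangle on
    which f_0 (sqrt (1 + q Z) - 1) ^ 2 has an integral of order 1 / n as soon as
    q >= b_n / n ([affinity_le], [covert_rate_lower]): a neighbourhood of the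
    origin in the light-tailed case, the strip L / 2 <= y <= L in the critical
    case, where all scales of y contribute equally and produce the logarithm, and
    L - 1 <= y <= L in the heavy-tailed case. *)

Local Open Scope classical_set_scope.
Local Open Scope ring_scope.

(** * Tensor products and total variation *)

Lemma measurable_tensor {d} {T : measurableType d} {R : realType} (g : T -> R) n :
  measurable_fun setT g -> measurable_fun setT (tensor g (n := n)).
Proof.
move=> mg; rewrite /tensor.
apply: measurable_prod => i _.
apply: measurableT_comp => //; exact: measurable_tnth.
Qed.

Local Open Scope ereal_scope.

Section sigma_finite_pushforward.
Context {d1 d2} {T1 : measurableType d1} {T2 : measurableType d2} {R : realType}.
Variables (m : {measure set T1 -> \bar R}) (F : T1 -> T2) (G : T2 -> T1).
Hypotheses (mF : measurable_fun setT F) (mG : measurable_fun setT G).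
Hypotheses (FK : cancel F G) (m_sigma_finite : sigma_finite setT m).

(** The measurable left inverse [G] pulls an exhaustion of [T1] back to [T2]; for
    a general map, sets of finite measure need not come from sets of [T2]. *)
Lemma sigma_finite_pushforward : sigma_finite setT (pushforward m F).
Proof.
have [A AT Afin] := m_sigma_finite.
exists (fun k => G @^-1` A k).
  by rewrite -preimage_bigcup -AT preimage_setT.
move=> k; have [mA Aoo] := Afin k; split.
  by rewrite -[X in measurable X]setTI; exact: mG.
by rewrite /pushforward -comp_preimage (_ : G \o F = id)//; apply/funext => x /=.
Qed.

Let pushforward_measure : {measure set T2 -> \bar R} :=
  measure_function_pushforward__canonical__measure_function_Measure m mF.

Definition sigma_finite_pushforward_measure :
    {sigma_finite_measure set T2 -> \bar R} :=
  HB.pack (Measure.sort pushforward_measure)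
    (Measure_isSigmaFinite.Build _ _ _ pushforward_measure
      sigma_finite_pushforward).

End sigma_finite_pushforward.
Arguments sigma_finite_pushforward_measure {d1 d2 T1 T2 R} m {F G}.

Section product_sigma_finite.
Context {d1 d2} {T1 : measurableType d1} {T2 : measurableType d2} {R : realType}.
Variables (m1 : {sigma_finite_measure set T1 -> \bar R})
  (m2 : {sigma_finite_measure set T2 -> \bar R}).

Lemma sigma_finite_product : sigma_finite setT (m1 \x m2).
Proof.
have /sigma_finiteP[F [FT Fnd Foo]] := sigma_finiteT m1.
have /sigma_finiteP[G [GT Gnd Goo]] := sigma_finiteT m2.
exists (fun n => F n `*` G n); last first.
  move=> n; have [mF mFoo] := Foo n; have [mG mGoo] := Goo n.
  split; first exact: measurableX.
  by rewrite product_measure1E// lte_mul_pinfty// ge0_fin_numE.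
apply/esym; rewrite -subTset => -[x y] _ /=.
have [i _ Fi] : (\bigcup_i F i) x by rewrite -FT.
have [j _ Gj] : (\bigcup_i G i) y by rewrite -GT.
exists (maxn i j) => //; split => /=.
- exact: (subsetPset _ _ (Fnd _ _ (leq_maxl i j))).
- exact: (subsetPset _ _ (Gnd _ _ (leq_maxr i j))).
Qed.

Let product_measure : {measure set (T1 * T2)%type -> \bar R} := m1 \x m2.

(** Products are iterated in [tuple_measure], so the product of two sigma-finite
    measures has to be available as a factor of another product. *)
Definition product_sigma_finite_measure :
    {sigma_finite_measure set (T1 * T2)%type -> \bar R} :=
  HB.pack (Measure.sort product_measure)
    (Measure_isSigmaFinite.Build _ _ _ product_measure sigma_finite_product).

End product_sigma_finite.

(** [tuple_measure] is a set function; [M] is the measure that it defines.  The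
    integral factorizes by Tonelli, one coordinate at a time. *)
Lemma integral_tensor {d} {T : measurableType d} {R : realType}
  (mu : {sigma_finite_measure set T -> \bar R}) n :
  exists2 M : {sigma_finite_measure set (n.-tuple T) -> \bar R},
    (M : set _ -> \bar R) = tuple_measure mu (n := n) &
    forall g : T -> R, measurable_fun setT g -> (forall x, 0 <= g x)%R ->
      \int[M]_x (tensor g x)%:E = (\int[mu]_x (g x)%:E) ^+ n.
Proof.
elim: n => [|n [M ME IH]].
  exists (dirac [tuple]) => // g mg g0.
  rewrite integral_dirac//.
    by rewrite diracT mul1e /tensor big_ord0 expe0.
  by apply/measurable_EFinP; exact: measurable_tensor.
pose F (p : T * n.-tuple T) := [tuple of p.1 :: p.2].
pose G (t : n.+1.-tuple T) : T * n.-tuple T := (thead t, [tuple of behead t]).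
have mF : measurable_fun setT F by exact: measurable_cons.
have mG : measurable_fun setT G.
  apply/measurable_fun_pair; [exact: measurable_tnth|exact: measurable_behead].
have FG : cancel F G.
  move=> [x t]; rewrite /F /G /=; congr pair.
  by apply: val_inj.
exists (sigma_finite_pushforward_measure (mu \x M) mF mG FG (sigma_finite_product mu M)).
  by rewrite /= ME.
move=> g mg g0.
have mt m : measurable_fun setT (EFin \o tensor g (n := m)).
  by apply/measurable_EFinP; exact: measurable_tensor.
have t0 m x : 0 <= (tensor g (n := m) x)%:E.
  by rewrite lee_fin; exact: prodr_ge0.
rewrite [LHS](@ge0_integral_pushforward _ _ _ _ _ F mF _ setT (fun x => (tensor g x)%:E))//.
rewrite preimage_setT fubini_tonelli1//=.
rewrite /fubini_F /=.
under eq_integral.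
  move=> x _.
  under eq_integral.
    move=> y _.
    rewrite /tensor big_ord_recl /= tnth0.
    under eq_bigr do rewrite tnthS.
    rewrite EFinM; over.
  rewrite /=.
  rewrite (ge0_integralZl _ _ (mt n))//; last 2 first.
    by move=> *; exact: t0.
    by rewrite lee_fin.
  rewrite IH//; over.
rewrite /= ge0_integralZr//=; last 3 first.
  exact/measurable_EFinP.
  by move=> x _; rewrite lee_fin.
  by apply: expe_ge0; apply: integral_ge0 => x _; rewrite lee_fin.
- by rewrite [RHS]expeS.
- exact: (measurableT_comp (mt _)).
- exact: mt.
Qed.

Local Close Scope ereal_scope.

Lemma tensorM {d} {T : measurableType d} {R : realType} (f g : T -> R) n :
  tensor (fun x => f x * g x) (n := n) = (fun t => tensor f t * tensor g t).
Proof. by apply/funext => t; rewrite /tensor big_split. Qed.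

Lemma tensor_sqrt {d} {T : measurableType d} {R : realType} (f : T -> R) n :
  (forall x, 0 <= f x) ->
  tensor (fun x => Num.sqrt (f x)) (n := n) = (fun t => Num.sqrt (tensor f t)).
Proof.
move=> f0; apply/funext => t; rewrite /tensor.
by elim/big_rec2: _ => [|i x y _ ->]; [rewrite sqrtr1|rewrite sqrtrM].
Qed.

Lemma measurable_sqrt {d} {T : measurableType d} {R : realType} (f : T -> R) :
  measurable_fun setT f -> measurable_fun setT (fun x => Num.sqrt (f x)).
Proof.
apply: measurableT_comp.
by apply: continuous_measurable_fun; exact: sqrt_continuous.
Qed.

(** The total variation is small exactly when the affinity is close to 1, and the
    affinity of n independent observations is the n-th power of that of one. *)
Section total_variation_bounds.
Context {d} {T : measurableType d} {R : realType}.
Variables (mu : {sigma_finite_measure set T -> \bar R}) (f0 f1 : T -> R) (rho : R).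
Hypotheses (mf0 : measurable_fun setT f0) (mf1 : measurable_fun setT f1).
Hypotheses (f0_ge0 : forall x, 0 <= f0 x) (f1_ge0 : forall x, 0 <= f1 x).
Hypotheses (int_f0 : (\int[mu]_x (f0 x)%:E = 1)%E) (int_f1 : (\int[mu]_x (f1 x)%:E = 1)%E).
Hypothesis int_rho : (\int[mu]_x (Num.sqrt (f0 x * f1 x))%:E = rho%:E)%E.
Variable n : nat.

Local Notation tv := (TV (tuple_measure mu (n := n)) (tensor f0 (n := n)) (tensor f1 (n := n))).
Local Open Scope ereal_scope.

Let affinity : exists2 M : {sigma_finite_measure set (n.-tuple T) -> \bar R},
  (M : set _ -> \bar R) = tuple_measure mu (n := n) &
  [/\ \int[M]_x (tensor f0 x)%:E = 1, \int[M]_x (tensor f1 x)%:E = 1 &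
     \int[M]_x (Num.sqrt (tensor f0 x * tensor f1 x))%:E = (rho ^+ n)%:E].
Proof.
have [M ME IM] := integral_tensor mu n; exists M => //; split.
- by rewrite IM// int_f0 -EFin_expe expr1n.
- by rewrite IM// int_f1 -EFin_expe expr1n.
- rewrite EFin_expe -int_rho -IM//.
    by rewrite tensor_sqrt ?tensorM// => x; rewrite mulr_ge0.
  by apply: measurable_sqrt; exact: measurable_funM.
Qed.

Let tge0 f (t : n.-tuple T) : (forall x, 0 <= f x)%R -> (0 <= tensor f t :> R)%R.
Proof. by move=> f_ge0; apply: prodr_ge0. Qed.

Let measurable_affinity :
  measurable_fun setT (fun t : n.-tuple T => Num.sqrt (tensor f0 t * tensor f1 t)).
Proof.
by apply: measurable_sqrt; apply: measurable_funM; exact: measurable_tensor.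
Qed.

Let measurable_diff :
  measurable_fun setT (fun t : n.-tuple T => `|tensor f0 t - tensor f1 t|)%R.
Proof.
apply: measurableT_comp => //.
by apply: measurable_funB; exact: measurable_tensor.
Qed.

(** Because min (a, b) <= sqrt (a b), one has a + b <= |a - b| + 2 sqrt (a b). *)
Lemma TV_tensor_ge : (1 - rho ^+ n)%:E <= tv.
Proof.
have [M ME [I0 I1 Ir]] := affinity.
rewrite /TV -ME.
set X := \int[M]_x _.
suff : 2%:E <= X + 2%:E * (rho ^+ n)%:E.
  rewrite -EFinM -leeBlDr// -EFinB => h.
  rewrite (_ : (1 - _)%R = (2^-1 * (2 - 2 * rho ^+ n))%R); last by field.
  by rewrite EFinM lee_pmul2l// lte_fin invr_gt0.
rewrite -Ir -ge0_integralZl//; last 1 first.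
  exact/measurable_EFinP.
rewrite -ge0_integralD//; last 2 first.
- exact/measurable_EFinP.
- by apply/measurable_EFinP; apply: measurable_funM => //.
rewrite [leLHS](_ : _ = 1 + 1)// -{1}I0 -I1 -ge0_integralD//; last 4 first.
- by move=> x _; rewrite lee_fin tge0.
- by apply/measurable_EFinP; exact: measurable_tensor.
- by move=> x _; rewrite lee_fin tge0.
- by apply/measurable_EFinP; exact: measurable_tensor.
apply: ge0_le_integral => //.
- by move=> x _; rewrite -EFinD lee_fin addr_ge0 ?tge0.
- by apply/measurable_EFinP; apply: measurable_funD; exact: measurable_tensor.
- by apply/measurable_EFinP; apply: measurable_funD => //; apply: measurable_funM.
move=> x _; rewrite -EFinM -!EFinD lee_fin.
have := tge0 f0 x f0_ge0; have := tge0 f1 x f1_ge0.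
move: (tensor f0 x) (tensor f1 x) => a b b0 a0.
rewrite sqrtrM//.
have := sqr_sqrtr a0; have := sqr_sqrtr b0.
have := sqrtr_ge0 a; have := sqrtr_ge0 b.
move: (Num.sqrt a) (Num.sqrt b) => u v v0 u0 <- <-.
have [uv|uv] := leP u v.
  rewrite ler0_norm; last by rewrite subr_le0 ler_sqr.
  nra.
rewrite ger0_norm; last by rewrite subr_ge0 ler_sqr// ltW.
nra.
Qed.

(** Write |a - b| = |sqrt a - sqrt b| (sqrt a + sqrt b).  Splitting the product by
    AM-GM with the free weight [c] replaces the Cauchy-Schwarz inequality, so that
    only integrals of nonnegative functions occur. *)
Lemma TV_tensor_le (c : R) : (0 < c)%R ->
  tv <= (2^-1 * ((1 - rho ^+ n) / c + 2 * c))%:E.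
Proof.
move=> c0.
have [M ME [I0 I1 Ir]] := affinity.
rewrite /TV -ME.
set X := \int[M]_x _.
suff : X + c^-1%:E * (rho ^+ n)%:E <= (2^-1 * c^-1 + c)%:E * 2%:E.
  rewrite -!EFinM -leeBrDr// -EFinB => h.
  rewrite EFinM lee_pmul2l//.
  apply: (le_trans h); rewrite lee_fin le_eqVlt; apply/orP; left.
  by apply/eqP; field; rewrite gt_eqF.
rewrite -Ir -ge0_integralZl//; last 2 first.
- exact/measurable_EFinP.
- by rewrite lee_fin invr_ge0 ltW.
rewrite -ge0_integralD//; last 3 first.
- exact/measurable_EFinP.
- by move=> x _; rewrite -EFinM lee_fin mulr_ge0// invr_ge0 ltW.
- by apply/measurable_EFinP; apply: measurable_funM => //.
rewrite (_ : 2%:E = 1 + 1)// -{1}I0 -I1 -ge0_integralD//; last 4 first.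
- by move=> x _; rewrite lee_fin tge0.
- by apply/measurable_EFinP; exact: measurable_tensor.
- by move=> x _; rewrite lee_fin tge0.
- by apply/measurable_EFinP; exact: measurable_tensor.
have k0 : (0 <= 2^-1 * c^-1 + c)%R by rewrite addr_ge0 ?mulr_ge0 ?invr_ge0 ?(ltW c0).
have mS : measurable_fun setT (fun t : n.-tuple T => (tensor f0 t + tensor f1 t)%R).
  by apply: measurable_funD; exact: measurable_tensor.
rewrite -ge0_integralZl//; last 2 first.
- by apply/measurable_EFinP.
- by move=> x _; rewrite -EFinD lee_fin addr_ge0 ?tge0.
apply: ge0_le_integral => //.
- by move=> x _; rewrite -EFinM -EFinD lee_fin addr_ge0 ?mulr_ge0 ?invr_ge0 ?(ltW c0).
- by apply/measurable_EFinP; apply: measurable_funD => //; apply: measurable_funM.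
- by apply/measurable_EFinP; apply: measurable_funM.
move=> x _; rewrite -EFinM -!EFinD lee_fin.
have := tge0 f0 x f0_ge0; have := tge0 f1 x f1_ge0.
move: (tensor f0 x) (tensor f1 x) => a b b0 a0.
rewrite sqrtrM//.
have := sqr_sqrtr a0; have := sqr_sqrtr b0.
have := sqrtr_ge0 a; have := sqrtr_ge0 b.
move: (Num.sqrt a) (Num.sqrt b) => u v v0 u0 <- <-.
have w0 : (0 < c^-1)%R by rewrite invr_gt0.
have cw : (c * c^-1 = 1)%R by rewrite divff// gt_eqF.
have key : (`|u ^+ 2 - v ^+ 2| <= 2^-1 * c^-1 * (u - v) ^+ 2 + 2^-1 * c * (u + v) ^+ 2)%R.
  (* s = 1 and s = -1 give the two halves of the absolute value *)
  have sq (s : R) : (s * (u - v) * (u + v) <= 2^-1 * c^-1 * (s * (u - v)) ^+ 2 + 2^-1 * c * (u + v) ^+ 2)%R.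
    have : (0 <= c^-1 * (s * (u - v) - c * (u + v)) ^+ 2)%R by rewrite mulr_ge0 ?sqr_ge0// ltW.
    rewrite (_ : (c^-1 * _ = c^-1 * (s * (u - v)) ^+ 2 - 2 * (c * c^-1) * (s * (u - v) * (u + v)) + (c * c^-1) * c * (u + v) ^+ 2)%R); last by ring.
    rewrite cw; lra.
  rewrite ler_norml; apply/andP; split.
    have := sq (-1)%R; nra.
  have := sq 1%R; nra.
have : (0 <= c * (u - v) ^+ 2)%R by rewrite mulr_ge0 ?sqr_ge0// ltW.
nra.
Qed.

End total_variation_bounds.

(** * Densities and joint laws *)

Local Open Scope ereal_scope.

(** Both sides are measures, so it is enough to compare them on the half-open
    intervals. *)
Lemma lebesgue_measure_translation {R : realType} (c : R) (A : set R) : measurable A ->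
  pushforward lebesgue_measure ((fun x : R => x + c)%R : _ -> measurableTypeR R) A =
  lebesgue_measure A.
Proof.
have mc : measurable_fun [set: R] (fun x : R => x + c)%R.
  exact: measurable_funD.
move=> mA; apply/esym/lebesgue_measure_unique => //=.
move=> _ [[a b]] _ <-.
rewrite /pushforward.
rewrite (_ : _ @^-1` _ = [set` `](a - c)%R, (b - c)%R]]); last first.
  by apply/seteqP; split => x /=; rewrite !in_itv/= ltrBlDr lerBrDr.
by rewrite !lebesgue_measure_itv/= !lte_fin ltrD2r -EFinB; congr (if _ then _%:E else _); ring.
Qed.

Lemma ge0_integral_translation {R : realType} (c : R) (f : R -> \bar R) :
  measurable_fun setT f -> (forall x, 0 <= f x) ->
  \int[lebesgue_measure]_x f (x + c)%R = \int[lebesgue_measure]_x f x.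
Proof.
move=> mf f0.
have mc : measurable_fun setT (fun x : measurableTypeR R => (x + c)%R : measurableTypeR R).
  have mc : measurable_fun [set: R] (fun x : R => x + c)%R by exact: measurable_funD.
  exact: mc.
transitivity (\int[pushforward lebesgue_measure ((fun x : R => x + c)%R : measurableTypeR R -> measurableTypeR R)]_x f x).
  by rewrite (ge0_integral_pushforward mc).
by apply: eq_measure_integral => // A mA _; exact: lebesgue_measure_translation.
Qed.

(** The Radon-Nikodym derivative of [nu] is almost everywhere the given [p]. *)
Lemma integral_density {d} {T : measurableType d} {R : realType}
  (mu : {sigma_finite_measure set T -> \bar R}) (nu : {finite_measure set T -> \bar R})
  (p : T -> R) (f : T -> \bar R) :
  measurable_fun setT p -> (forall x, 0 <= p x)%R ->
  (forall A, measurable A -> nu A = \int[mu]_(x in A) (p x)%:E) ->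
  measurable_fun setT f -> (forall x, 0 <= f x) ->
  \int[nu]_x f x = \int[mu]_x (f x * (p x)%:E).
Proof.
move=> mp p0 nuE mf f0.
have mpE : measurable_fun setT (EFin \o p) by exact/measurable_EFinP.
have numu : nu `<< mu.
  apply/null_content_dominatesP => A mA A0.
  by rewrite nuE// null_set_integral//; exact: measurable_funTS.
have pint : mu.-integrable setT (EFin \o p).
  apply/integrableP; split => //.
  under eq_integral do rewrite /= ger0_norm//.
  by rewrite -nuE// ltey_eq fin_num_measure.
rewrite -(Radon_Nikodym_SigmaFinite.change_of_variables numu f0 measurableT mf).
have fint := Radon_Nikodym_SigmaFinite.f_integrable numu.
have mRN := measurable_int _ fint.
apply: ge0_ae_eq_integral => //.
- exact: emeasurable_funM.
- exact: emeasurable_funM.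
- by move=> x _; rewrite mule_ge0// Radon_Nikodym_SigmaFinite.f_ge0.
- by move=> x _; rewrite mule_ge0// lee_fin.
have : ae_eq mu setT (Radon_Nikodym_SigmaFinite.f nu mu) (EFin \o p).
  apply: integral_ae_eq => // E _ mE.
  by rewrite -Radon_Nikodym_SigmaFinite.f_integral// nuE.
by apply: filterS => x h _; rewrite h.
Qed.

(** Independence in product form.  The factor [c] is there because the lemma is
    applied to a probability restricted to an event of probability [c], namely an
    outcome of Alice's coin. *)
Lemma joint_law_pair {d d1 d2} {Omega : measurableType d} {T1 : measurableType d1}
  {T2 : measurableType d2} {R : realType} (Q : {measure set Omega -> \bar R})
  (c : {nonneg R}) (m1 : probability T1 R) (m2 : probability T2 R)
  (X : Omega -> T1) (Y : Omega -> T2) :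
  measurable_fun setT X -> measurable_fun setT Y ->
  (forall A B, measurable A -> measurable B ->
     Q (X @^-1` A `&` Y @^-1` B) = c%:num%:E * (m1 A * m2 B)) ->
  forall D, measurable D ->
    Q ((fun w => (X w, Y w)) @^-1` D) = c%:num%:E * (m1 \x m2) D.
Proof.
move=> mX mY QE D mD.
have mXY : measurable_fun setT (fun w => (X w, Y w)) by exact: measurable_fun_pair.
pose q0 : {measure set (T1 * T2)%type -> \bar R} := pushforward Q (fun w => (X w, Y w)).
pose q := q0 mXY.
transitivity ((mscale c m1 \x m2) D).
  apply/esym.
  apply: (@product_measure_unique _ _ _ _ _ (mscale c m1) m2 q) => // A B mA mB.
  rewrite [LHS](_ : _ = Q (X @^-1` A `&` Y @^-1` B))// QE//.
  by rewrite muleA.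
rewrite /product_measure1 ge0_integral_mscale//.
exact: measurable_fun_xsection.
Qed.

(** Restrict first to [X @^-1` A] and group [(Y, Z)], then add [X]. *)
Lemma joint_law_triple {d d1 d2 d3} {Omega : measurableType d} {T1 : measurableType d1}
  {T2 : measurableType d2} {T3 : measurableType d3} {R : realType} (P : probability Omega R)
  (c : {nonneg R}) (m1 : probability T1 R) (m2 : probability T2 R) (m3 : probability T3 R)
  (X : Omega -> T1) (Y : Omega -> T2) (Z : Omega -> T3) (E : set Omega) :
  measurable E ->
  measurable_fun setT X -> measurable_fun setT Y -> measurable_fun setT Z ->
  (forall A B C, measurable A -> measurable B -> measurable C ->
     P (E `&` (X @^-1` A `&` (Y @^-1` B `&` Z @^-1` C))) =
     c%:num%:E * (m1 A * (m2 B * m3 C))) ->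
  forall D, measurable D ->
    P (E `&` (fun w => (X w, (Y w, Z w))) @^-1` D) =
    c%:num%:E * (m1 \x (m2 \x m3)) D.
Proof.
move=> mE mX mY mZ PE D mD.
have mYZ : measurable_fun setT (fun w => (Y w, Z w)) by exact: measurable_fun_pair.
rewrite setIC.
rewrite (_ : P _ = mrestr P mE ((fun w => (X w, (Y w, Z w))) @^-1` D))//.
apply: (@joint_law_pair _ _ _ _ _ _ _ (mrestr P mE) c m1 (m2 \x m3)%E X (fun w => (Y w, Z w))) => //.
move=> A B mA mB.
have mXA : measurable (X @^-1` A) by rewrite -[X in measurable X]setTI; exact: mX.
have mEA := measurableI _ _ mE mXA.
have fA : m1 A \is a fin_num by exact: fin_num_measure.
have c'0 : (0 <= c%:num * fine (m1 A))%R by rewrite mulr_ge0// fine_ge0.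
have := @joint_law_pair _ _ _ _ _ _ _ (mrestr P mEA) (NngNum c'0) m2 m3 Y Z mY mZ _ B mB.
rewrite /= EFinM fineK// -muleA => <-; last first.
  move=> A' B' mA' mB'; rewrite -muleA -PE// /mrestr.
  by congr (P _); rewrite setIC -setIA.
rewrite /mrestr; congr (P _).
by rewrite setIC setIA setIC.
Qed.

(** * Lebesgue measure on the line and on the plane *)

Section lebesgue_structure.
Context {R : realType}.

Let idT : measurableTypeR R -> R := id.
Let idR : R -> measurableTypeR R := id.

Let midT : measurable_fun setT idT. Proof. by move=> _ A mA; rewrite setTI. Qed.
Let midR : measurable_fun setT idR. Proof. by move=> _ A mA; rewrite setTI. Qed.

(** [measurableTypeR R] is [R] under another display.  Pushing Lebesgue measure
    forward along the identity gives a measure on [R] itself with the same values;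
    [leb2] does the same for the plane and is [lebesgue2] as a set function. *)
Definition lebR : {sigma_finite_measure set R -> \bar R} :=
  sigma_finite_pushforward_measure (@lebesgue_measure R) midT midR (fun=> erefl)
    (sigma_finiteT (@lebesgue_measure R)).

Lemma integral_lebR (D : set R) (f : R -> \bar R) : measurable D ->
  measurable_fun D f -> (forall x, D x -> 0 <= f x) ->
  \int[lebR]_(x in D) f x = \int[lebesgue_measure]_(x in D) f x.
Proof.
move=> mD mf f0.
rewrite [LHS](@ge0_integral_pushforward _ _ _ _ _ idT midT _ D f)//.
by move=> x /set_mem; exact: f0.
Qed.

Lemma integral_lebR_patch (D : set R) (f : R -> R) : measurable D ->
  measurable_fun setT f -> (forall x, 0 <= f x)%R ->
  \int[lebR]_x ((f \_ D) x)%:E = \int[lebesgue_measure]_(x in D) (f x)%:E.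
Proof.
move=> mD mf f0.
rewrite (_ : (fun x => ((f \_ D) x)%:E) = (EFin \o f) \_ D); last by rewrite restrict_EFin.
rewrite -integral_mkcond integral_lebR//.
- by apply: measurable_funTS; exact/measurable_EFinP.
- by move=> x _; rewrite lee_fin.
Qed.

Let idT2 : measurableTypeR R * measurableTypeR R -> R * R := id.
Let idR2 : R * R -> measurableTypeR R * measurableTypeR R := id.

Let midT2 : measurable_fun setT idT2.
Proof. by move=> _ A mA; rewrite setTI. Qed.
Let midR2 : measurable_fun setT idR2.
Proof. by move=> _ A mA; rewrite setTI. Qed.

Definition leb2 : {sigma_finite_measure set (R * R)%type -> \bar R} :=
  sigma_finite_pushforward_measure (lebesgue_measure \x lebesgue_measure) midT2 midR2 (fun=> erefl)
    (sigma_finite_product (@lebesgue_measure R) (@lebesgue_measure R)).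

Lemma leb2E : (leb2 : set (R * R) -> \bar R) = lebesgue2.
Proof. by []. Qed.

(** The two set functions agree on rectangles, hence on all measurable sets. *)
Lemma leb2_product A : measurable A -> leb2 A = (lebR \x lebR) A.
Proof.
move=> mA; apply/esym; apply: product_measure_unique => // B C mB mC.
by rewrite [LHS](product_measure1E (@lebesgue_measure R) (@lebesgue_measure R)).
Qed.

Lemma integral_lebesgue2 (f : R * R -> \bar R) : measurable_fun setT f ->
  (forall x, 0 <= f x) ->
  \int[lebesgue2]_x f x = \int[lebR]_t \int[lebR]_y f (y, t).
Proof.
move=> mf f0; rewrite -leb2E.
rewrite (eq_measure_integral (lebR \x lebR)%E); last first.
  by move=> A mA _; exact: leb2_product.
by rewrite fubini_tonelli2.
Qed.

Lemma integral_lebesgue2_set (B : set (R * R)) (f : R * R -> \bar R) :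
  measurable B -> measurable_fun setT f -> (forall x, 0 <= f x) ->
  \int[lebesgue2]_(x in B) f x =
  \int[lebR]_t \int[lebR]_y ((\1_B (y, t))%:E * f (y, t)).
Proof.
move=> mB mf f0.
transitivity (\int[lebesgue2]_x (f x * (\1_B x)%:E)).
  by rewrite -leb2E [LHS]integral_mkcond epatch_indic.
rewrite [LHS]integral_lebesgue2.
- by apply: eq_integral => t _; apply: eq_integral => y _; rewrite muleC.
- by apply: emeasurable_funM => //; apply/measurable_EFinP; exact: measurable_indic.
- by move=> x; rewrite mule_ge0//= lee_fin.
Qed.

Lemma integral_lebR_translation (c : R) (f : R -> \bar R) :
  measurable_fun setT f -> (forall x, 0 <= f x) ->
  \int[lebR]_x f (x + c)%R = \int[lebR]_x f x.
Proof.
move=> mf f0; rewrite !integral_lebR//.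
  exact: ge0_integral_translation.
by apply: (measurableT_comp mf); exact: measurable_funD.
Qed.

End lebesgue_structure.

(** * The density of a shifted sum *)

(** Given [X = t] and [Y = u], the variable [Z + k t u] has the density
    [fun y => pZ (y - k t u)]; integrating [u] out leaves [H (y, t)].  The event
    [E] is an outcome of Alice's coin. *)
Section density_shifted_sum.
Context {d} {Omega : measurableType d} {R : realType} (P : probability Omega R).
Variables (E : set Omega) (c : {nonneg R}) (X Y Z : {mfun Omega >-> R}).
Variables (pX pY pZ : R -> R) (k : R -> R -> R) (H : R * R -> R).
Hypothesis mE : measurable E.
Hypothesis indep : forall A B C, measurable A -> measurable B -> measurable C ->
  P (E `&` (X @^-1` A `&` (Y @^-1` B `&` Z @^-1` C))) =
  c%:num%:E * (P (X @^-1` A) * (P (Y @^-1` B) * P (Z @^-1` C))).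
Hypotheses (mpX : measurable_fun setT pX) (mpY : measurable_fun setT pY)
  (mpZ : measurable_fun setT pZ).
Hypotheses (pX_ge0 : forall x, (0 <= pX x)%R) (pY_ge0 : forall x, (0 <= pY x)%R)
  (pZ_ge0 : forall x, (0 <= pZ x)%R).
Hypotheses
  (XE : forall A, measurable A -> P (X @^-1` A) = \int[lebR]_(x in A) (pX x)%:E)
  (YE : forall A, measurable A -> P (Y @^-1` A) = \int[lebR]_(x in A) (pY x)%:E)
  (ZE : forall A, measurable A -> P (Z @^-1` A) = \int[lebR]_(x in A) (pZ x)%:E).
Hypothesis mk : measurable_fun setT (fun p : R * R => k p.1 p.2).
Hypotheses (mH : measurable_fun setT H) (H_ge0 : forall x, (0 <= H x)%R).
Hypothesis HE : forall t y,
  \int[lebR]_u (pX t * (pY u * pZ (y - k t u)))%:E = (H (y, t))%:E.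

Lemma density_shifted_sum B : measurable B ->
  P (E `&` [set w | B (Z w + k (X w) (Y w), X w)%R]) =
  c%:num%:E * \int[lebesgue2]_(x in B) (H x)%:E.
Proof.
move=> mB.
pose phi (p : R * (R * R)) := (p.2.2 + k p.1 p.2.1, p.1)%R.
have mphi : measurable_fun setT phi.
  apply: measurable_fun_pair => //; apply: measurable_funD.
    exact: (measurableT_comp measurable_snd measurable_snd).
  apply: (measurableT_comp mk (g := fun p : R * (R * R) => (p.1, p.2.1))).
  apply: measurable_fun_pair => //.
  exact: (measurableT_comp measurable_fst measurable_snd).
pose D := phi @^-1` B.
have mD : measurable D by rewrite -[X in measurable X]setTI; exact: mphi.
have := @joint_law_triple _ _ _ _ _ _ _ _ _ P c (distribution P X) (distribution P Y)
  (distribution P Z) X Y Z E mE (measurable_funPT _) (measurable_funPT _) (measurable_funPT _)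
  indep D mD.
move=> ->; congr (_ * _).
rewrite /product_measure1 (integral_density lebR (distribution P X) pX)//; last 2 first.
- pose m23 := product_sigma_finite_measure (distribution P Y) (distribution P Z).
  exact: (@measurable_fun_xsection _ _ _ _ _ m23 _ mD).
- by move=> t; apply: integral_ge0 => u _.
pose G t u y := (pX t * (pY u * pZ (y - k t u)) * \1_B (y, t))%R.
have G0 t u y : (0 <= G t u y)%R by rewrite /G !mulr_ge0.
have mI t : measurable_fun setT (fun y => \1_B (y, t) : R).
  by apply: (measurableT_comp (measurable_indic mB)); exact: pair2_measurable.
have mkt t : measurable_fun setT (k t).
  by apply: (measurableT_comp mk (g := fun u => (t, u))); exact: pair1_measurable.
have section t u : distribution P Z (xsection (xsection D t) u) =
    \int[lebR]_y (pZ (y - k t u) * \1_B (y, t))%:E.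
  have mS : measurable (xsection (xsection D t) u).
    by apply: measurable_xsection; exact: measurable_xsection.
  rewrite [LHS]ZE// integral_mkcond epatch_indic.
  rewrite -[RHS](integral_lebR_translation (k t u))//; last 2 first.
  - apply/measurable_EFinP; apply: measurable_funM => //.
    by apply: measurableT_comp => //; exact: measurable_funB.
  - by move=> y; rewrite lee_fin mulr_ge0.
  apply: eq_integral => s _; rewrite addrK EFinM; congr (_ * _%:E).
  rewrite !indicE; congr (nat_of_bool _)%:R.
  by rewrite !mem_xsection; apply/idP/idP; rewrite !inE.
transitivity (\int[lebR]_t \int[lebR]_y (\1_B (y, t) * H (y, t))%:E).
  apply: eq_integral => t _.
  have mG : measurable_fun setT (fun p : R * R => (G t p.1 p.2)%:E).
    apply/measurable_EFinP; apply: measurable_funM; last first.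
      exact: (measurableT_comp (mI t)).
    apply: measurable_funM => //; apply: measurable_funM => //.
      exact: (measurableT_comp mpY).
    apply: (measurableT_comp mpZ); apply: measurable_funB => //.
    exact: (measurableT_comp (mkt t)).
  transitivity (\int[lebR]_u \int[lebR]_y (G t u y)%:E).
    rewrite /= (integral_density lebR (distribution P Y) pY)//; last first.
      by apply: measurable_fun_xsection; exact: measurable_xsection.
    rewrite -ge0_integralZr//; last 3 first.
    - apply: emeasurable_funM; last exact/measurable_EFinP.
      by apply: measurable_fun_xsection; exact: measurable_xsection.
    - by move=> u _; rewrite mule_ge0// lee_fin.
    - by rewrite lee_fin.
    apply: eq_integral => u _; rewrite -/(distribution P Z _) section.
    rewrite -muleA -EFinM -ge0_integralZr//; last 3 first.
    - apply/measurable_EFinP; apply: measurable_funM => //.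
      by apply: measurableT_comp => //; exact: measurable_funB.
    - by move=> y _; rewrite lee_fin mulr_ge0.
    - by rewrite lee_fin mulr_ge0.
    by apply: eq_integral => y _; rewrite -EFinM /G; congr (_%:E); ring.
  rewrite (fubini_tonelli (fun p : R * R => (G t p.1 p.2)%:E))//; last first.
    by move=> p; rewrite lee_fin.
  apply: eq_integral => y _; rewrite EFinM -HE -ge0_integralZl//; last 2 first.
  - apply/measurable_EFinP; apply: measurable_funM => //; apply: measurable_funM => //.
    by apply: (measurableT_comp mpZ); exact: measurable_funB.
  - by move=> u _; rewrite lee_fin !mulr_ge0.
  - by apply: eq_integral => u _; rewrite /= -EFinM /G mulrC.
have mHE : measurable_fun setT (EFin \o H) by exact/measurable_EFinP.
rewrite (integral_lebesgue2_set B (EFin \o H) mB mHE) => [|x]; last by rewrite lee_fin.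
by apply: eq_integral => t _; apply: eq_integral => y _; rewrite EFinM.
Qed.
End density_shifted_sum.

Local Close Scope ereal_scope.

(** * Exponential integrals *)

Section exponential_integrals.
Context {R : realType}.
Implicit Types c s x y : R.
Local Notation mu := (@lebesgue_measure R).

(** A primitive of [fun x => expR (c * x)] that also covers [c = 0]. *)
Definition expR_primitive c x : R := if c == 0 then x else expR (c * x) / c.

Lemma is_derive_expR_primitive c x :
  is_derive x 1 (expR_primitive c) (expR (c * x)).
Proof.
rewrite /expR_primitive; have [->|c0] := eqVneq c 0.
  rewrite mul0r expR0; exact: is_derive_id.
have -> : (fun x => expR (c * x) / c) = c^-1 \*: (fun x => expR (c * x)).
  by apply/funext => z /=; rewrite mulrC.
apply: is_derive_eq.
by rewrite /GRing.scale /= mulr1 mulrCA mulVf// mulr1.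
Qed.

Lemma continuous_expR_scale c : continuous (fun x : R => expR (c * x)).
Proof.
move=> x; apply: (@continuous_comp _ _ _ (fun x => c * x) expR).
  by apply: cvgM; [exact: cvg_cst|exact: cvg_id].
exact: continuous_expR.
Qed.

Lemma measurable_expR_scale c : measurable_fun setT (fun x : R => expR (c * x)).
Proof. by apply: continuous_measurable_fun; exact: continuous_expR_scale. Qed.

Lemma continuous_expR_primitive c : continuous (expR_primitive c).
Proof.
move=> x; apply/differentiable_continuous/derivable1_diffP.
by have [] := is_derive_expR_primitive c x.
Qed.

Lemma integral_expR_scale c (a b : R) : a <= b ->
  (\int[mu]_(x in `[a, b]) (expR (c * x))%:E =
   (expR_primitive c b - expR_primitive c a)%:E)%E.
Proof.
rewrite le_eqVlt => /orP[/eqP<-|ab].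
  by rewrite set_itv1 integral_set1 subrr.
have cF := continuous_expR_primitive c.
rewrite (@continuous_FTC2 _ _ (expR_primitive c))//.
- by apply: continuous_subspaceT; exact: continuous_expR_scale.
- split.
  + by move=> x _; have [] := is_derive_expR_primitive c x.
  + exact/cvg_at_right_filter/cF.
  + exact/cvg_at_left_filter/cF.
- move=> x _; rewrite derive1E.
  by have [_ ->] := is_derive_expR_primitive c x.
Qed.

Lemma integral_expR_scaley c (a : R) : c < 0 ->
  (\int[mu]_(x in `[a, +oo[) (expR (c * x))%:E = (expR (c * a) / - c)%:E)%E.
Proof.
move=> c0.
have cF := continuous_expR_primitive c.
rewrite (@ge0_continuous_FTC2y _ _ (expR_primitive c) _ 0)//.
- by rewrite add0e -EFinN /expR_primitive lt_eqF// invrN mulrN.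
- by apply: continuous_subspaceT; exact: continuous_expR_scale.
- rewrite /expR_primitive lt_eqF//.
  rewrite -(mul0r c^-1); apply: cvgMl.
  rewrite (_ : (fun x => expR (c * x)) = (fun z => expR (- z)) \o (fun z => (- c) * z)).
    apply: (@cvg_comp _ _ _ _ _ _ (pinfty_nbhs R)); last exact: cvgr_expR.
    by apply: gt0_cvgMry; rewrite ?oppr_gt0.
  by apply/funext => x /=; rewrite mulNr opprK.
- by move=> x _; have [] := is_derive_expR_primitive c x.
- exact/cvg_at_right_filter/cF.
- move=> x _; rewrite derive1E.
  by have [_ ->] := is_derive_expR_primitive c x.
Qed.

Lemma expR_primitiveD c s x :
  expR_primitive c (s + x) - expR_primitive c s =
  expR (c * s) * (expR_primitive c x - expR_primitive c 0).
Proof.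
rewrite /expR_primitive; have [->|c0] := eqVneq c 0.
  by rewrite mul0r expR0; ring.
by rewrite mulrDr expRD mulr0 expR0; field.
Qed.

Lemma expR_primitiveB_ge0 c y : 0 <= y -> 0 <= expR_primitive c y - expR_primitive c 0.
Proof.
move=> y0; rewrite -lee_fin -integral_expR_scale//.
by apply: integral_ge0 => x _; rewrite lee_fin expR_ge0.
Qed.

Lemma expR_primitiveB_neq0 c y : c != 0 ->
  expR_primitive c y - expR_primitive c 0 = (expR (c * y) - 1) / c.
Proof. by move=> /negbTE c0; rewrite /expR_primitive c0 mulr0 expR0 mulrBl. Qed.

Lemma expR_primitiveB_le0 c y : c <= 0 -> 0 <= y ->
  expR_primitive c y - expR_primitive c 0 <= y.
Proof.
rewrite le_eqVlt => /orP[/eqP-> y0|c0 y0]; first by rewrite /expR_primitive eqxx subr0.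
rewrite expR_primitiveB_neq0 ?lt_eqF// ler_ndivrMr//.
by rewrite lerBrDl mulrC expR_ge1Dx.
Qed.

Lemma expR_primitiveB_le c y : 0 <= y <= 1 ->
  expR_primitive c y - expR_primitive c 0 <= y * expR `|c|.
Proof.
move=> /andP[y0 y1]; have e1 : 1 <= expR `|c| by rewrite -expR0 ler_expR.
have [c0|c0] := leP c 0.
  by rewrite (le_trans (expR_primitiveB_le0 _ _ c0 y0))// ler_peMr.
rewrite expR_primitiveB_neq0 ?gt_eqF// ler_pdivrMr//.
apply: (@le_trans _ _ (c * y * expR (c * y))).
  have := expR_ge1Dx (- (c * y)); rewrite expRN => h.
  have e0 := expR_gt0 (c * y).
  have : (1 + - (c * y)) * expR (c * y) <= 1 by rewrite -ler_pdivlMr// mul1r.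
  by move: (expR (c * y)) => e; nra.
rewrite [leRHS]mulrAC (mulrC y); apply: ler_wpM2l; first by rewrite mulr_ge0// ltW.
by rewrite ler_expR gtr0_norm// ler_piMr// ltW.
Qed.

Lemma expR_primitiveB_le_inv c y : c < 0 -> expR_primitive c y - expR_primitive c 0 <= (- c)^-1.
Proof.
move=> c0; rewrite expR_primitiveB_neq0 ?lt_eqF// ler_ndivrMr// invrN mulNr mulVf ?lt_eqF//.
by rewrite lerBrDr addrC subrr expR_ge0.
Qed.

Lemma expR_primitiveB_le_expR c y : 0 < c -> expR_primitive c y - expR_primitive c 0 <= expR (c * y) / c.
Proof.
move=> c0; rewrite expR_primitiveB_neq0 ?gt_eqF// ler_pM2r ?invr_gt0//.
by rewrite gerBl.
Qed.

End exponential_integrals.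

(** * The law of one observation *)

Section iebp_density.
Context {R : realType}.
Variables lambda mu1 mu2 : R.
Hypotheses (lambda_gt0 : 0 < lambda) (mu1_gt0 : 0 < mu1) (mu2_gt0 : 0 < mu2).
Local Notation pdf := exponential_pdf.

(** The ratio [(g1 * g2) / g1], where [g1 * g2] is the convolution of the
    exponential densities of rates [mu1] and [mu2]. *)
Definition delay_ratio (y : R) : R :=
  mu2 * (expR_primitive (mu1 - mu2) y - expR_primitive (mu1 - mu2) 0).

(** The relative perturbation [f_1 / f_0 - 1] caused by an insertion. *)
Definition delay_score (p : R * R) : R :=
  expR (- mu2 * p.2) * (delay_ratio p.1 - 1).

Definition iebp_density (q : R) (p : R * R) : R :=
  pdf lambda p.2 * (pdf mu1 p.1 * (1 + q * delay_score p)).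

(** Alice's job is gone by time [t] on [`[0, t]] and otherwise delays Willie's job
    by [u - t <= y]: two exponential integrals, the second one over an interval of
    length [y] shifted by [t]. *)
Lemma integral_delayed_service (t y : R) : 0 <= t -> 0 <= y ->
  (\int[lebR]_u (pdf mu2 u * pdf mu1 (y - Num.max (u - t) 0))%:E =
  (pdf mu1 y * (1 + delay_score (y, t)))%:E)%E.
Proof.
move=> t0 y0.
pose f1 (u : R) : R := mu2 * mu1 * expR (- mu1 * y) * expR (- mu2 * u).
pose f2 (u : R) : R := mu2 * mu1 * expR (- mu1 * (y + t)) * expR ((mu1 - mu2) * u).
have f1_ge0 u : 0 <= f1 u by rewrite /f1 !mulr_ge0 ?expR_ge0// ltW.
have f2_ge0 u : 0 <= f2 u by rewrite /f2 !mulr_ge0 ?expR_ge0// ltW.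
have mexp := @measurable_expR_scale R.
have mf1 : measurable_fun setT f1 by apply: measurable_funM.
have mf2 : measurable_fun setT f2 by apply: measurable_funM.
pose D1 : set R := `[0, t]%classic; pose D2 : set R := `]t, (t + y)]%classic.
transitivity (\int[lebR]_u ((EFin \o (f1 \_ D1)) u + (EFin \o (f2 \_ D2)) u))%E.
  apply: eq_integral => u _ /=; rewrite -EFinD !patchE !mem_setE !in_itv/=.
  have [u0|u0] := ltP u 0.
    rewrite lt0_exponential_pdf// mul0r (_ : t < u = false) ?addr0//.
    by apply/negbTE; rewrite -leNgt (le_trans (ltW u0)).
  have [ut|tu] := leP u t.
    rewrite /= addr0 max_r ?subr_le0// subr0 !exponential_pdfE//.
    by rewrite /f1; congr (_%:E); ring.
  rewrite /= add0r max_l; last by rewrite subr_ge0 ltW.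
  have [uy|uy] := leP u (t + y).
    rewrite !exponential_pdfE//; last by lra.
    rewrite /f2; congr (_%:E).
    rewrite mulrACA -[RHS]mulrA -!expRD; congr (_ * expR _); ring.
  by rewrite [X in _ * X]lt0_exponential_pdf ?mulr0//; lra.
have mp1 (D : set R) (f : R -> R) : measurable D -> measurable_fun setT f -> measurable_fun setT (EFin \o (f \_ D) : R -> \bar R).
  move=> mD mf; apply/measurable_EFinP.
  by rewrite -measurable_restrictT//; exact: measurable_funTS.
have p_ge0 (D : set R) (f : R -> R) x : (forall u, 0 <= f u) -> (0 <= (EFin \o (f \_ D)) x :> \bar R)%E.
  by move=> f0; rewrite /= lee_fin patchE; case: ifPn.
rewrite ge0_integralD//; last 4 first.
- by move=> x _; exact: p_ge0.
- by apply: mp1 => //; exact: measurable_itv.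
- by move=> x _; exact: p_ge0.
- by apply: mp1 => //; exact: measurable_itv.
have [mD1 mD2] : measurable D1 /\ measurable D2 by split; exact: measurable_itv.
rewrite !integral_lebR_patch// /D1 /D2 integral_itv_obnd_cbnd; last by apply: measurable_funTS; exact/measurable_EFinP.
have intZ (c k a b : R) : 0 <= k -> a <= b ->
    (\int[lebesgue_measure]_(u in `[a, b]) (k * expR (c * u))%:E =
     (k * (expR_primitive c b - expR_primitive c a))%:E)%E.
  move=> k0 ab; under eq_integral do rewrite EFinM.
  have mE : measurable_fun `[a, b] (fun x : R => (expR (c * x))%:E).
    by apply: measurable_funTS; apply/measurable_EFinP; exact: mexp.
  rewrite ge0_integralZl//.
  by rewrite integral_expR_scale.
rewrite /f1 /f2 !intZ//; last 3 first.
- by rewrite !mulr_ge0 ?expR_ge0// ltW.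
- by rewrite lerDl.
- by rewrite !mulr_ge0 ?expR_ge0// ltW.
rewrite -EFinD; congr (_%:E); rewrite expR_primitiveD exponential_pdfE//.
rewrite /delay_score /delay_ratio /=.
rewrite {1 2}/expR_primitive oppr_eq0 gt_eqF// mulr0 expR0.
have eE : expR (- mu1 * (y + t)) * expR ((mu1 - mu2) * t) = expR (- mu1 * y) * expR (- mu2 * t).
  by rewrite -!expRD; congr expR; ring.
move: (expR_primitive _ y - _) => r.
rewrite [in X in _ + X]mulrA -[X in _ + X * r]mulrA eE.
by field; rewrite gt_eqF.
Qed.

End iebp_density.

Section iebp_law.
Context {R : realType}.
Variables lambda mu1 mu2 : R.
Hypotheses (lambda_gt0 : 0 < lambda) (mu1_gt0 : 0 < mu1) (mu2_gt0 : 0 < mu2).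
Local Notation pdf := exponential_pdf.
Local Notation density := (iebp_density lambda mu1 mu2).

Lemma delay_ratio_ge0 (y : R) : 0 <= y -> 0 <= delay_ratio mu1 mu2 y.
Proof.
by move=> y0; apply: mulr_ge0; [exact: ltW|exact: expR_primitiveB_ge0].
Qed.

(** [1 + delay_score p] is a ratio of densities. *)
Lemma delay_score_ge (p : R * R) : 0 <= p.1 -> 0 <= p.2 -> -1 <= delay_score mu1 mu2 p.
Proof.
move=> y0 t0; rewrite /delay_score.
have := delay_ratio_ge0 _ y0; move: (delay_ratio _ _ _) => r r0.
have e1 : expR (- mu2 * p.2) <= 1.
  by rewrite -expR0 ler_expR mulNr oppr_le0 mulr_ge0// ltW.
have := expR_ge0 (- mu2 * p.2); nra.
Qed.

Lemma iebp_density_outside (q : R) (p : R * R) : (p.1 < 0) || (p.2 < 0) -> density q p = 0.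
Proof.
by rewrite /iebp_density => /orP[]/lt0_exponential_pdf ->; rewrite ?mul0r ?mulr0.
Qed.

Lemma iebp_density_ge0 (q : R) (p : R * R) : 0 <= q <= 1 -> 0 <= density q p.
Proof.
move=> /andP[q0 q1].
have [/iebp_density_outside -> //|] := boolP ((p.1 < 0) || (p.2 < 0)).
rewrite negb_or -!leNgt => /andP[y0 t0].
apply: mulr_ge0; first by rewrite exponential_pdf_ge0// ltW.
apply: mulr_ge0; first by rewrite exponential_pdf_ge0// ltW.
have := delay_score_ge _ y0 t0; nra.
Qed.

Lemma measurable_delay_score : measurable_fun setT (delay_score mu1 mu2).
Proof.
have mexp := @measurable_expR_scale R.
apply: measurable_funM; first exact: (measurableT_comp (mexp _)).
apply: measurable_funB => //.
apply: (@measurableT_comp _ _ _ _ _ _ (delay_ratio mu1 mu2)) => //.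
apply: measurable_funM => //; apply: measurable_funB => //.
by apply: continuous_measurable_fun; exact: continuous_expR_primitive.
Qed.

Lemma measurable_iebp_density (q : R) : measurable_fun setT (density q).
Proof.
apply: measurable_funM; first by apply: measurableT_comp => //; exact: measurable_exponential_pdf.
apply: measurable_funM; first by apply: measurableT_comp => //; exact: measurable_exponential_pdf.
apply: measurable_funD => //; apply: measurable_funM => //.
exact: measurable_delay_score.
Qed.

Lemma integral_exponential_lebR (r : R) : 0 < r -> (\int[lebR]_x (pdf r x)%:E = 1)%E.
Proof.
move=> r0; rewrite integral_lebR//; first exact: integral_exponential_pdf.
- by apply/measurable_EFinP; exact: measurable_exponential_pdf.
- by move=> x _; rewrite lee_fin exponential_pdf_ge0// ltW.
Qed.

(** The maximum is outside the test on [b 0], which makes the identity hold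
    pointwise: without an insertion the delay is the negative part of [tau 0],
    which vanishes almost surely. *)
Lemma observation0E (tau s1 s2 : nat -> R) (b : nat -> bool) :
  observation tau s1 s2 b 0 =
  (s1 0%N + Num.max ((if b 0%N then s2 0%N else 0) - tau 0%N) 0, tau 0%N).
Proof.
rewrite /observation /wbp_end /= /reconstructed /= /arrival big_ord1 subr0 add0r.
congr (_, _); rewrite addrAC addrC; congr (_ + _).
by rewrite addr_maxl subrr maxC.
Qed.

Section law.
Context {d : measure_display} {Omega : measurableType d}.
Variables (P : probability Omega R) (tau s1 s2 : nat -> {mfun Omega >-> R})
  (b : nat -> {mfun Omega >-> bool}) (q : R).
Hypotheses (q01 : 0 <= q <= 1).
Hypothesis model : iebp_model P tau s1 s2 b lambda mu1 mu2 q.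

(** The contribution of the outcome [c] of Alice's coin; [k] is the delay as a
    function of the arrival time and of Alice's service time. *)
Let law_branch (c : bool) (p : {nonneg R}) (H : R * R -> R) (k : R -> R -> R) :
  P (b 0%N @^-1` [set c]) = p%:num%:E ->
  measurable_fun setT H -> (forall x, 0 <= H x) ->
  measurable_fun setT (fun p : R * R => k p.1 p.2) ->
  (forall t y, \int[lebR]_u (pdf lambda t * (pdf mu2 u * pdf mu1 (y - k t u)))%:E = (H (y, t))%:E)%E ->
  forall B, measurable B ->
  P (b 0%N @^-1` [set c] `&` [set w | B (s1 0%N w + k (tau 0%N w) (s2 0%N w), tau 0%N w)]) =
  (p%:num%:E * \int[lebesgue2]_(x in B) (H x)%:E)%E.
Proof.
move=> Pc mH H0 mk HE B mB.
have mp r : measurable_fun setT (pdf r : R -> R) by exact: measurable_exponential_pdf.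
have p0 (r : R) x : 0 < r -> 0 <= pdf r x by move=> r0; rewrite exponential_pdf_ge0// ltW.
have law (r : R) (X : {mfun Omega >-> R}) A : 0 < r -> exponential_law P r X -> measurable A ->
   P (X @^-1` A) = (\int[lebR]_(x in A) (pdf r x)%:E)%E.
  move=> r0 XE mA; rewrite XE// integral_lebR//.
  - by apply: measurable_funTS; apply/measurable_EFinP.
  - by move=> x _; rewrite lee_fin p0.
have lawX := iebp_interarrival model 0; have lawY := iebp_service2 model 0.
have lawZ := iebp_service1 model 0.
apply: (@density_shifted_sum _ _ _ P _ p (tau 0%N) (s2 0%N) (s1 0%N) (pdf lambda) (pdf mu2) (pdf mu1) k H) => //;
  try by move=> x; exact: p0.
- by rewrite -[X in measurable X]setTI; exact: measurable_funPT.
- move=> A1 A2 A3 mA1 mA2 mA3; rewrite -Pc.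
  pose E (i : (nat + nat) + (nat + nat)) : set Omega :=
    match i with
    | inl (inl _) => tau 0%N @^-1` A1
    | inl (inr _) => s1 0%N @^-1` A3
    | inr (inl _) => s2 0%N @^-1` A2
    | inr (inr _) => b 0%N @^-1` [set c]
    end.
  have := iebp_independent model (s := [:: inr (inr 0%N); inl (inl 0%N); inr (inl 0%N); inl (inr 0%N)]) (E := E) isT.
  rewrite !big_cons !big_nil /= setIT mule1; apply.
  move=> i; rewrite !inE => /or4P[] /eqP ->; rewrite /= /sigma_of /preimage_set_system /=.
  + by exists [set c]; rewrite ?setTI.
  + by exists A1; rewrite ?setTI.
  + by exists A2; rewrite ?setTI.
  + by exists A3; rewrite ?setTI.
- by move=> A mA; apply: law.
- by move=> A mA; apply: law.
- by move=> A mA; apply: law.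
Qed.

(** Condition on Alice's coin: the law is the mixture of the laws for [q = 1] and
    [q = 0], and [density q] is affine in [q]. *)
Lemma iebp_observation_law B : measurable B ->
  P (iebp_observation tau s1 s2 b 0 @^-1` B) =
  (\int[leb2]_(x in B) (density q x)%:E)%E.
Proof.
move=> mB.
have /andP[q0 q1] := q01.
pose k (c : bool) (t u : R) := Num.max ((if c then u else 0) - t) 0.
have mk c : measurable_fun setT (fun p : R * R => k c p.1 p.2).
  apply: measurable_maxr => //; apply: measurable_funB => //.
  by case: c; [exact: measurable_snd|exact: measurable_cst].
have mbt c : measurable (b 0%N @^-1` [set c]).
  by rewrite -[X in measurable X]setTI; exact: measurable_funPT.
have split_b c : b 0%N @^-1` [set c] `&` iebp_observation tau s1 s2 b 0 @^-1` B =
   b 0%N @^-1` [set c] `&` [set w | B (s1 0%N w + k c (tau 0%N w) (s2 0%N w), tau 0%N w)].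
  apply/seteqP; split => w /= [bw]; rewrite /iebp_observation observation0E bw; by split.
have qn0 : 0 <= 1 - q by rewrite subr_ge0.
have PT : P (b 0%N @^-1` [set true]) = q%:E by exact: iebp_insertion model 0.
have PF : P (b 0%N @^-1` [set false]) = (1 - q)%:E.
  rewrite (_ : _ @^-1` _ = ~` (b 0%N @^-1` [set true])).
    by rewrite probability_setC// PT.
  by apply/seteqP; split => w /=; case: (b 0%N w).
pose S c := [set w | B (s1 0%N w + k c (tau 0%N w) (s2 0%N w), tau 0%N w)].
have mS c : measurable (S c).
  have mf : measurable_fun setT
      (fun w => (s1 0%N w + k c (tau 0%N w) (s2 0%N w), tau 0%N w)).
    apply: measurable_fun_pair => //; apply: measurable_funD => //.
    apply: (measurableT_comp (mk c) (g := fun w => (tau 0%N w, s2 0%N w))).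
    exact: measurable_fun_pair.
  by rewrite -[X in measurable X]setTI; exact: mf.
have -> : iebp_observation tau s1 s2 b 0 @^-1` B =
    (b 0%N @^-1` [set true] `&` S true) `|` (b 0%N @^-1` [set false] `&` S false).
  rewrite -!split_b -setIUl -preimage_setU (_ : _ `|` _ = setT) ?preimage_setT ?setTI//.
  by apply/seteqP; split => // -[] _ /=; [left|right].
rewrite measureU; [|exact: measurableI|exact: measurableI|]; last first.
  by apply/seteqP; split => // w /= [[-> _] []].
have HT t y : (\int[lebR]_u (pdf lambda t * (pdf mu2 u * pdf mu1 (y - k true t u)))%:E =
    (density 1 (y, t))%:E)%E.
  have [t0|t0] := ltP t 0.
    rewrite iebp_density_outside ?t0 ?orbT// integral0_eq// => u _.
    by rewrite lt0_exponential_pdf// mul0r.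
  have [y0|y0] := ltP y 0.
    rewrite iebp_density_outside ?y0// integral0_eq// => u _.
    rewrite [X in _ * (_ * X)]lt0_exponential_pdf ?mulr0//.
    by rewrite (le_lt_trans _ y0)// lerBlDr lerDl le_max lexx orbT.
  under eq_integral do rewrite EFinM.
  rewrite ge0_integralZl//; last 3 first.
  - apply/measurable_EFinP; apply: measurable_funM; first exact: measurable_exponential_pdf.
    apply: measurableT_comp; first exact: measurable_exponential_pdf.
    apply: measurable_funB => //.
    have := measurableT_comp (mk true) (pair1_measurable t).
    exact.
  - by move=> u _; rewrite lee_fin mulr_ge0// exponential_pdf_ge0// ltW.
  - by rewrite lee_fin exponential_pdf_ge0// ltW.
  by rewrite integral_delayed_service// /iebp_density mul1r -EFinM.
have HF t y : (\int[lebR]_u (pdf lambda t * (pdf mu2 u * pdf mu1 (y - k false t u)))%:E =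
    (density 0 (y, t))%:E)%E.
  have [t0|t0] := ltP t 0.
    rewrite iebp_density_outside ?t0 ?orbT// integral0_eq// => u _.
    by rewrite lt0_exponential_pdf// mul0r.
  under eq_integral do rewrite /k sub0r max_r ?oppr_le0// subr0 mulrCA mulrC EFinM.
  rewrite ge0_integralZl//; last 3 first.
  - by apply/measurable_EFinP; exact: measurable_exponential_pdf.
  - by move=> u _; rewrite lee_fin exponential_pdf_ge0// ltW.
  - by rewrite lee_fin mulr_ge0// exponential_pdf_ge0// ltW.
  by rewrite integral_exponential_lebR// mule1 /iebp_density mul0r addr0 mulr1.
have one01 : 0 <= (1 : R) <= 1 by rewrite ler01 lexx.
have zero01 : 0 <= (0 : R) <= 1 by rewrite ler01 lexx.
have LT := @law_branch true (NngNum q0) (density 1) (k true) PT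
  (measurable_iebp_density 1) (fun x => iebp_density_ge0 _ _ one01) (mk true) HT B mB.
have LF := @law_branch false (NngNum qn0) (density 0) (k false) PF
  (measurable_iebp_density 0) (fun x => iebp_density_ge0 _ _ zero01) (mk false) HF B mB.
transitivity (q%:E * (\int[leb2]_(x in B) (density 1 x)%:E) +
    (1 - q)%:E * (\int[leb2]_(x in B) (density 0 x)%:E))%E.
  by congr (_ + _)%E; [exact: LT|exact: LF].
have md r : measurable_fun B (fun x => (density r x)%:E).
  by apply: measurable_funTS; apply/measurable_EFinP; exact: measurable_iebp_density.
rewrite -!ge0_integralZl//; [|by move=> x _; rewrite lee_fin iebp_density_ge0..].
rewrite -ge0_integralD//.
- by apply: eq_integral => x _; rewrite -!EFinM -EFinD /iebp_density; congr (_%:E); ring.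
- by move=> x _; rewrite mule_ge0// lee_fin ?iebp_density_ge0.
- by apply: measurable_funeM.
- by move=> x _; rewrite mule_ge0// lee_fin ?iebp_density_ge0.
- by apply: measurable_funeM.
Qed.
End law.
End iebp_law.

Section density_ae.
Context {R : realType}.
Variables lambda mu1 mu2 : R.
Hypotheses (lambda_gt0 : 0 < lambda) (mu1_gt0 : 0 < mu1) (mu2_gt0 : 0 < mu2).
Context {d : measure_display} {Omega : measurableType d}.
Variables (P : probability Omega R) (tau s1 s2 : nat -> {mfun Omega >-> R})
  (b : nat -> {mfun Omega >-> bool}) (q : R) (f : R * R -> R).
Hypotheses (q01 : 0 <= q <= 1).
Hypothesis model : iebp_model P tau s1 s2 b lambda mu1 mu2 q.
Hypothesis fE : has_density P lebesgue2 (iebp_observation tau s1 s2 b 0) f.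

Lemma integral_density_one : (\int[leb2]_x (f x)%:E = 1)%E.
Proof.
have [_ _ /(_ setT measurableT)] := fE.
by rewrite preimage_setT probability_setT leb2E => <-.
Qed.

(** Both functions are densities of the same law. *)
Lemma density_aeE : ae_eq leb2 setT (EFin \o f) (EFin \o iebp_density lambda mu1 mu2 q).
Proof.
have [mf f0 fB] := fE.
apply: integral_ae_eq => //.
- apply/integrableP; split; first exact/measurable_EFinP.
  under eq_integral do rewrite /= ger0_norm//.
  by rewrite integral_density_one ltry.
- by apply/measurable_EFinP; exact: measurable_iebp_density.
- move=> E _ mE; rewrite -(iebp_observation_law _ _ _ _ _ _ _ _ _ _ _ _ q01 model)//.
  by rewrite fB// leb2E.
Qed.

End density_ae.

(** * The Hellinger affinity of one observation *)

Section sqrt_bounds.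
Context {R : realType}.
Implicit Types x K : R.

(** These bounds come from x = (s - 1) (s + 1) with s = sqrt (1 + x). *)
Lemma sqrt1D_sub1_le x : -1 <= x ->
  (Num.sqrt (1 + x) - 1) ^+ 2 <= x ^+ 2 /\ (Num.sqrt (1 + x) - 1) ^+ 2 <= `|x|.
Proof.
move=> x1; have x10 : 0 <= 1 + x by lra.
have := sqr_sqrtr x10; have := sqrtr_ge0 (1 + x); move: (Num.sqrt _) => s s0 sE.
have -> : x = (s - 1) * (s + 1) by rewrite -subr_sqr expr1n sE; ring.
split; first by rewrite exprMn ler_peMr ?sqr_ge0// exprn_ege1//; lra.
rewrite normrM (ger0_norm (_ : 0 <= s + 1)); last by lra.
rewrite -real_normK ?num_real// expr2 ler_wpM2l// ler_norml; apply/andP; split; lra.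
Qed.

Lemma sqrt1D_sub1_ge_neg x : -1 <= x -> x <= 0 ->
  x ^+ 2 / 4 <= (Num.sqrt (1 + x) - 1) ^+ 2.
Proof.
move=> x1 xle0; have x10 : 0 <= 1 + x by lra.
have := sqr_sqrtr x10; have := sqrtr_ge0 (1 + x); move: (Num.sqrt _) => s s0 sE.
have s1 : s <= 1 by rewrite -(@ler_pXn2r _ 2)// ?nnegrE// sE expr1n; lra.
have -> : x = (s - 1) * (s + 1) by rewrite -subr_sqr expr1n sE; ring.
rewrite exprMn -mulrA ler_piMr ?sqr_ge0//; nra.
Qed.

(** The left factor is monotone in [x], so a lower bound [x0] of [x] is enough;
    [K] then bounds the denominator. *)
Lemma sqrt1D_sub1_ge_pos x0 x K : 0 <= x0 -> x0 <= x -> x0 <= K ->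
  x0 ^+ 2 / (2 + K) ^+ 2 <= (Num.sqrt (1 + x) - 1) ^+ 2.
Proof.
move=> x00 x0x x0K.
rewrite -expr_div_n ler_sqr ?nnegrE; last 2 first.
- by rewrite divr_ge0//; lra.
- by rewrite subr_ge0 -[leLHS]sqrtr1 ler_sqrt; lra.
apply: (@le_trans _ _ (Num.sqrt (1 + x0) - 1)); last first.
  by rewrite lerB// ler_sqrt; lra.
have x10 : 0 <= 1 + x0 by lra.
have := sqr_sqrtr x10; have := sqrtr_ge0 (1 + x0); move: (Num.sqrt _) => s s0 sE.
have s1 : 1 <= s by rewrite -(@ler_pXn2r _ 2)// ?nnegrE// sE expr1n; lra.
rewrite ler_pdivrMr; last by lra.
have -> : x0 = (s - 1) * (s + 1) by rewrite -subr_sqr expr1n sE; ring.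
apply: ler_wpM2l; first by lra.
suff : s <= 1 + x0 by lra.
by rewrite -sE; nra.
Qed.

End sqrt_bounds.

Section single_letter.
Context {R : realType}.
Variables lambda mu1 mu2 : R.
Hypotheses (lambda_gt0 : 0 < lambda) (mu1_gt0 : 0 < mu1) (mu2_gt0 : 0 < mu2).
Local Notation pdf := exponential_pdf.
Local Notation density := (iebp_density lambda mu1 mu2).
Local Notation score := (delay_score mu1 mu2).
Variables (q : R) (f0 f1 : R * R -> R).
Hypotheses (q01 : 0 <= q <= 1).
Hypotheses (mf0 : measurable_fun setT f0) (mf1 : measurable_fun setT f1).
Hypotheses (f0_ge0 : forall x, 0 <= f0 x) (f1_ge0 : forall x, 0 <= f1 x).
Hypotheses (int_f0 : (\int[leb2]_x (f0 x)%:E = 1)%E) (int_f1 : (\int[leb2]_x (f1 x)%:E = 1)%E).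
Hypotheses (f0E : ae_eq leb2 setT (EFin \o f0) (EFin \o density 0))
  (f1E : ae_eq leb2 setT (EFin \o f1) (EFin \o density q)).

Let measurable_affinity1 : measurable_fun setT (fun x => Num.sqrt (f0 x * f1 x)).
Proof. by apply: measurable_sqrt; exact: measurable_funM. Qed.

Lemma affinity_ex : exists2 rho : R, 0 <= rho <= 1 &
  (\int[leb2]_x (Num.sqrt (f0 x * f1 x))%:E = rho%:E)%E.
Proof.
have I0 : (0 <= \int[leb2]_x (Num.sqrt (f0 x * f1 x))%:E)%E.
  by apply: integral_ge0 => x _; rewrite lee_fin sqrtr_ge0.
have I2 : (2%:E * \int[leb2]_x (Num.sqrt (f0 x * f1 x))%:E <= 2%:E)%E.
  rewrite -ge0_integralZl//; last 1 first.
  - exact/measurable_EFinP.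
  rewrite [leRHS](_ : _ = 1 + 1)%E// -{1}int_f0 -int_f1 -ge0_integralD//; last 4 first.
  - by move=> x _; rewrite lee_fin.
  - exact/measurable_EFinP.
  - by move=> x _; rewrite lee_fin.
  - exact/measurable_EFinP.
  apply: ge0_le_integral => //.
  - by apply/measurable_EFinP; apply: measurable_funM.
  - by apply/measurable_EFinP; apply: measurable_funD.
  move=> x _; rewrite -EFinM -EFinD lee_fin sqrtrM//.
  have := sqr_sqrtr (f0_ge0 x); have := sqr_sqrtr (f1_ge0 x).
  move: (Num.sqrt _) (Num.sqrt _) => u v <- <-.
  have := sqr_ge0 (u - v); nra.
have : (\int[leb2]_x (Num.sqrt (f0 x * f1 x))%:E)%E \is a fin_num.
  rewrite ge0_fin_numE// ltNge; apply/negP; rewrite leye_eq => /eqP Ioo.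
  by move: I2; rewrite Ioo gt0_muley.
move=> /fineK IE; exists (fine (\int[leb2]_x (Num.sqrt (f0 x * f1 x))%:E)%E); last by rewrite IE.
rewrite fine_ge0//=; move: I2; rewrite -IE -EFinM lee_fin; lra.
Qed.

Variable rho : R.
Hypothesis int_rho : (\int[leb2]_x (Num.sqrt (f0 x * f1 x))%:E = rho%:E)%E.

(** f0 + f1 - 2 sqrt (f0 f1) is the square of sqrt f1 - sqrt f0; outside the
    quadrant both densities vanish. *)
Let hellinger p : f0 p = density 0 p -> f1 p = density q p ->
  f0 p + f1 p - 2 * Num.sqrt (f0 p * f1 p) =
  density 0 p * (Num.sqrt (1 + q * score p) - 1) ^+ 2.
Proof.
move=> -> ->.
have [h|] := boolP ((p.1 < 0) || (p.2 < 0)).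
  by rewrite !iebp_density_outside// !mul0r sqrtr0 mulr0 addr0 subrr.
rewrite negb_or -!leNgt => /andP[y0 t0].
have z1 := delay_score_ge mu1 mu2 mu2_gt0 p y0 t0.
have qz : 0 <= 1 + q * score p by case/andP: q01 => *; nra.
have d0 := iebp_density_ge0 lambda mu1 mu2 lambda_gt0 mu1_gt0 mu2_gt0 0 p.
have -> : density q p = density 0 p * (1 + q * score p).
  by rewrite /iebp_density mul0r addr0 mulr1 mulrA.
have {}d0 : 0 <= density 0 p by apply: d0; rewrite lexx ler01.
rewrite mulrA -expr2 sqrtrM ?sqr_ge0// sqrtr_sqr ger0_norm//.
have := sqr_sqrtr qz; move: (Num.sqrt _) => s sE.
by rewrite -sE; ring.
Qed.

Let int_f01 : (\int[leb2]_x (f0 x + f1 x)%:E = 2%:E)%E.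
Proof.
under eq_integral do rewrite EFinD.
rewrite ge0_integralD ?int_f0 ?int_f1//.
- by move=> x _; rewrite lee_fin.
- exact/measurable_EFinP.
- by move=> x _; rewrite lee_fin.
- exact/measurable_EFinP.
Qed.

Let int_sqrtD (h : R * R -> R) : measurable_fun setT h -> (forall x, 0 <= h x) ->
  (\int[leb2]_x (2 * Num.sqrt (f0 x * f1 x) + h x)%:E =
  (2 * rho)%:E + \int[leb2]_x (h x)%:E)%E.
Proof.
move=> mh h0; under eq_integral do rewrite EFinD EFinM.
have msE : measurable_fun setT (fun x => (Num.sqrt (f0 x * f1 x))%:E : \bar R).
  exact/measurable_EFinP.
rewrite ge0_integralD//.
- by rewrite ge0_integralZl// int_rho EFinM.
- by apply: measurable_funeM.
- by move=> x _; rewrite lee_fin.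
- exact/measurable_EFinP.
Qed.

Let hellinger_ae : {ae leb2, forall p, f0 p + f1 p =
  2 * Num.sqrt (f0 p * f1 p) + density 0 p * (Num.sqrt (1 + q * score p) - 1) ^+ 2}.
Proof.
apply: filterS2 f0E f1E => p /(_ I) [e0] /(_ I) [e1].
by rewrite -hellinger// [RHS]addrC subrK.
Qed.

(** Keep only the part of the Hellinger integral over [A]. *)
Lemma affinity_le (A : set (R * R)) (c : R) : measurable A -> 0 <= c ->
  (forall p, A p -> c <= density 0 p * (Num.sqrt (1 + q * score p) - 1) ^+ 2) ->
  ((2 * rho)%:E + c%:E * leb2 A <= 2%:E)%E.
Proof.
move=> mA c0 cA.
have mI : measurable_fun setT (fun x : R * R => c * \1_A x).
  by apply: measurable_funM => //; exact: measurable_indic.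
have I0 x : 0 <= c * \1_A x by rewrite mulr_ge0.
have IA : (c%:E * leb2 A = \int[leb2]_x (c * \1_A x)%:E)%E.
  under eq_integral do rewrite EFinM.
  rewrite ge0_integralZl//; last by apply/measurable_EFinP; exact: measurable_indic.
  by rewrite integral_indic// setIT.
rewrite IA.
rewrite -int_sqrtD// -int_f01.
apply: ae_ge0_le_integral => //.
- by move=> x _; rewrite lee_fin addr_ge0// mulr_ge0// sqrtr_ge0.
- by apply/measurable_EFinP; apply: measurable_funD => //; exact: measurable_funM.
- by move=> x _; rewrite lee_fin addr_ge0.
- by apply/measurable_EFinP; exact: measurable_funD.
apply: filterS hellinger_ae => p -> _; rewrite lee_fin lerD2l indicE.
have [/set_mem Ap|_] := boolP (p \in A); first by rewrite mulr1 cA.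
by rewrite mulr0 mulr_ge0 ?sqr_ge0// iebp_density_ge0// lexx ler01.
Qed.

(** The arrival density integrates to 1, so only the service factor remains. *)
Let integral_product (h : R -> R) : measurable_fun setT h -> (forall x, 0 <= h x) ->
  (\int[leb2]_p (pdf lambda p.2 * h p.1)%:E = \int[lebR]_y (h y)%:E)%E.
Proof.
move=> mh h0.
have mhE : measurable_fun setT (fun y => (h y)%:E) by exact/measurable_EFinP.
rewrite leb2E integral_lebesgue2.
- transitivity (\int[lebR]_t ((pdf lambda t)%:E * \int[lebR]_y (h y)%:E))%E.
    apply: eq_integral => t _; under eq_integral do rewrite /= EFinM.
    rewrite ge0_integralZl//.
    + by move=> x _; rewrite lee_fin.
    + by rewrite lee_fin exponential_pdf_ge0// ltW.
  rewrite ge0_integralZr//.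
  + by rewrite integral_exponential_lebR// mul1e.
  + by apply/measurable_EFinP; exact: measurable_exponential_pdf.
  + by move=> x _; rewrite lee_fin exponential_pdf_ge0// ltW.
  + by apply: integral_ge0 => y _; rewrite lee_fin.
- apply/measurable_EFinP; apply: measurable_funM; apply: measurableT_comp => //.
  exact: measurable_exponential_pdf.
- by move=> x; rewrite lee_fin mulr_ge0// exponential_pdf_ge0// ltW.
Qed.

(** With [|delay_score p| <= K * expR (a * y)], bound the integrand by its square
    up to the cutoff [L] and by its absolute value beyond. *)
Lemma affinity_ge (K a L : R) : a < mu1 -> 0 <= L -> 0 <= K ->
  (forall y, 0 <= y -> delay_ratio mu1 mu2 y + 1 <= K * expR (a * y)) ->
  2 <= 2 * rho +
    (q ^+ 2 * K ^+ 2 * mu1 * (expR_primitive (2 * a - mu1) L - expR_primitive (2 * a - mu1) 0)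
     + q * K * mu1 * (expR ((a - mu1) * L) / (mu1 - a))).
Proof.
move=> amu1 L0 K0 rK.
have /andP[q0 q1] := q01.
pose h1 y := q ^+ 2 * K ^+ 2 * mu1 * expR ((2 * a - mu1) * y).
pose h2 y := q * K * mu1 * expR ((a - mu1) * y).
pose D1 : set R := `[0, L]%classic; pose D2 : set R := `[L, +oo[%classic.
have [mD1 mD2] : measurable D1 /\ measurable D2 by split; exact: measurable_itv.
pose h y := (h1 \_ D1) y + (h2 \_ D2) y.
have mexp := @measurable_expR_scale R.
have mh1 : measurable_fun setT h1 by apply: measurable_funM.
have mh2 : measurable_fun setT h2 by apply: measurable_funM.
have h1_ge0 y : 0 <= h1 y by rewrite /h1 !mulr_ge0 ?expR_ge0 ?sqr_ge0// ltW.
have h2_ge0 y : 0 <= h2 y by rewrite /h2 !mulr_ge0 ?expR_ge0// ltW.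
have p1_ge0 y : 0 <= (h1 \_ D1) y by rewrite patchE; case: ifPn.
have p2_ge0 y : 0 <= (h2 \_ D2) y by rewrite patchE; case: ifPn.
have mp1 : measurable_fun setT (h1 \_ D1).
  by rewrite -measurable_restrictT//; exact: measurable_funTS.
have mp2 : measurable_fun setT (h2 \_ D2).
  by rewrite -measurable_restrictT//; exact: measurable_funTS.
have mh : measurable_fun setT h by exact: measurable_funD.
have h_ge0 y : 0 <= h y by rewrite addr_ge0.
have int_h : (\int[lebR]_y (h y)%:E =
   (q ^+ 2 * K ^+ 2 * mu1 * (expR_primitive (2 * a - mu1) L - expR_primitive (2 * a - mu1) 0)
     + q * K * mu1 * (expR ((a - mu1) * L) / (mu1 - a)))%:E)%E.
  under eq_integral do rewrite EFinD.
  rewrite ge0_integralD//; last 4 first.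
  - by move=> y _; rewrite lee_fin.
  - exact/measurable_EFinP.
  - by move=> y _; rewrite lee_fin.
  - exact/measurable_EFinP.
  rewrite !integral_lebR_patch// /h1 /h2.
  have meE (D : set R) (c : R) : measurable_fun D (fun x : R => (expR (c * x))%:E).
    by apply: measurable_funTS; apply/measurable_EFinP; exact: mexp.
  rewrite EFinD; congr (_ + _)%E.
    under eq_integral do rewrite EFinM.
    rewrite ge0_integralZl//; last by rewrite lee_fin !mulr_ge0 ?sqr_ge0// ltW.
    + by rewrite integral_expR_scale.
    + exact: meE.
  under eq_integral do rewrite EFinM.
  rewrite ge0_integralZl//; last by rewrite lee_fin !mulr_ge0// ltW.
  - by rewrite integral_expR_scaley ?subr_lt0// opprB.
  - exact: meE.
rewrite -lee_fin [leRHS]EFinD -int_h -integral_product// -int_sqrtD; last 2 first.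
- apply: measurable_funM; apply: measurableT_comp => //.
  exact: measurable_exponential_pdf.
- by move=> p; rewrite mulr_ge0// exponential_pdf_ge0// ltW.
rewrite -int_f01; apply: ae_ge0_le_integral => //.
- by move=> x _; rewrite lee_fin addr_ge0.
- by apply/measurable_EFinP; exact: measurable_funD.
- by move=> x _; rewrite lee_fin addr_ge0 ?mulr_ge0 ?sqrtr_ge0 ?exponential_pdf_ge0// ltW.
- apply/measurable_EFinP; apply: measurable_funD; first exact: measurable_funM.
  apply: measurable_funM; apply: measurableT_comp => //.
  exact: measurable_exponential_pdf.
apply: filterS hellinger_ae => p -> _; rewrite lee_fin lerD2l.
have [out|] := boolP ((p.1 < 0) || (p.2 < 0)).
  by rewrite iebp_density_outside// mul0r mulr_ge0// exponential_pdf_ge0// ltW.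
rewrite negb_or -!leNgt => /andP[y0 t0].
rewrite /iebp_density mul0r addr0 mulr1 -mulrA.
apply: ler_wpM2l; first by rewrite exponential_pdf_ge0// ltW.
rewrite exponential_pdfE//.
have z1 := delay_score_ge mu1 mu2 mu2_gt0 p y0 t0.
have zK : `|score p| <= K * expR (a * p.1).
  apply: le_trans (rK _ y0).
  have e1 : expR (- mu2 * p.2) <= 1.
    by rewrite -expR0 ler_expR mulNr oppr_le0 mulr_ge0// ltW.
  have e0 := expR_ge0 (- mu2 * p.2).
  have r0 := delay_ratio_ge0 mu1 mu2 mu2_gt0 p.1 y0.
  by rewrite ler_norml /delay_score; apply/andP; split; nra.
have qz1 : -1 <= q * score p by nra.
have [W2 W1] := sqrt1D_sub1_le _ qz1.
have qE : `|q * score p| <= q * (K * expR (a * p.1)).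
  by rewrite normrM ger0_norm// ler_wpM2l.
rewrite /h.
have [yL|Ly] := leP p.1 L.
  apply: (@le_trans _ _ ((h1 \_ D1) p.1)); last by rewrite lerDl.
  rewrite patchE mem_set; last by rewrite /D1 /= in_itv/= y0.
  rewrite /h1 (_ : (2 * a - mu1) * p.1 = a * p.1 + a * p.1 + - mu1 * p.1); last by ring.
  rewrite !expRD.
  have W3 : (q * score p) ^+ 2 <= (q * (K * expR (a * p.1))) ^+ 2.
    by rewrite -(real_normK (num_real (q * score p))) ler_sqr ?nnegrE// (le_trans _ qE).
  apply: (@le_trans _ _ (mu1 * expR (- mu1 * p.1) * (q * (K * expR (a * p.1))) ^+ 2)).
    apply: ler_wpM2l; last exact: le_trans W2 _.
    by rewrite mulr_ge0 ?expR_ge0// ltW.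
  by rewrite le_eqVlt; apply/orP; left; apply/eqP; ring.
apply: (@le_trans _ _ ((h2 \_ D2) p.1)); last by rewrite lerDr.
rewrite patchE mem_set; last by rewrite /D2 /= in_itv/= andbT ltW.
rewrite /h2 (_ : (a - mu1) * p.1 = a * p.1 + - mu1 * p.1); last by ring.
rewrite !expRD.
apply: (@le_trans _ _ (mu1 * expR (- mu1 * p.1) * (q * (K * expR (a * p.1))))).
  apply: ler_wpM2l; last exact: le_trans W1 _.
    by rewrite mulr_ge0 ?expR_ge0// ltW.
by rewrite le_eqVlt; apply/orP; left; apply/eqP; ring.
Qed.

End single_letter.

(** * The critical insertion probability *)

Section scales.
Context {R : realType}.
Variables mu1 mu2 : R.
Hypotheses (mu1_gt0 : 0 < mu1) (mu2_gt0 : 0 < mu2).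
Local Notation a := (mu1 - mu2).
Local Notation rate n := (covert_scale mu1 mu2 n / n%:R).

(** For [mu2 < mu1] the exponent is [mu1 - mu2].  Otherwise the ratio grows at most
    linearly, and any small positive exponent will do; it is taken to be
    [mu1 / 4]. *)
Lemma delay_ratio_growth : exists K b : R, [/\ 0 <= K, b < mu1,
  forall y, 0 <= y -> delay_ratio mu1 mu2 y + 1 <= K * expR (b * y),
  mu1 < 2 * mu2 -> 2 * b < mu1 & 2 * mu2 <= mu1 -> b = a].
Proof.
have m1 := mu1_gt0; have m2 := mu2_gt0.
have [a0|a0] := ltP 0 a.
  exists (mu2 / a + 1), a; split => //.
  - by rewrite addr_ge0// divr_ge0// ltW.
  - by rewrite ltrBlDr ltrDl.
  - move=> y y0; rewrite /delay_ratio expR_primitiveB_neq0 ?gt_eqF//.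
    have e1 : 1 <= expR (a * y) by rewrite -expR0 ler_expR mulr_ge0// ltW.
    have k0 : 0 < mu2 / a by rewrite divr_gt0.
    rewrite mulrCA mulrC; move: (expR _) (mu2 / a) e1 k0 => e k *; nra.
  - by move=> *; lra.
exists (1 + 4 * mu2 / mu1), (mu1 / 4); split.
- by rewrite addr_ge0// divr_ge0 ?mulr_ge0// ltW.
- lra.
- move=> y y0; have ry : delay_ratio mu1 mu2 y <= mu2 * y.
    by rewrite /delay_ratio ler_pM2l// expR_primitiveB_le0.
  apply: (@le_trans _ _ (mu2 * y + 1)); first by rewrite lerD2r.
  have k0 : 0 < mu2 / mu1 by rewrite divr_gt0.
  apply: (@le_trans _ _ ((1 + 4 * mu2 / mu1) * (1 + mu1 / 4 * y))); last first.
    by rewrite ler_wpM2l ?expR_ge1Dx// -mulrA; lra.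
  have -> : (1 + 4 * mu2 / mu1) * (1 + mu1 / 4 * y) = 1 + 4 * (mu2 / mu1) + mu1 * y / 4 + mu2 * y.
    by field; rewrite gt_eqF.
  have : 0 <= mu1 * y by rewrite mulr_ge0// ltW.
  lra.
- move=> _; lra.
- move=> *; lra.
Qed.

(** Everything is expressed through [x = ln n] and the cutoff [x / mu1], at which
    [expR (mu1 * y)] equals [n]. *)
Section asymptotics.
Variable n : nat.
Hypothesis ln_ge1 : 1 <= ln n%:R :> R.
Local Notation x := (ln (n%:R : R)).
Local Notation L := (x / mu1).

Lemma natr_gt0_ln_ge1 : 0 < n%:R :> R.
Proof.
rewrite ltNge; apply/negP => n0; move: ln_ge1.
by rewrite ln0// ler10.
Qed.

Lemma natr_expR_ln : n%:R = expR x :> R.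
Proof. by rewrite lnK// posrE natr_gt0_ln_ge1. Qed.

Lemma mulr_cutoff : mu1 * L = x.
Proof. by rewrite mulrC divfK// gt_eqF. Qed.

Lemma sqrt_expR (z : R) : Num.sqrt (expR z) = expR (z / 2).
Proof. by rewrite {1}(splitr z) expRD -expr2 sqrtr_sqr ger0_norm// expR_ge0. Qed.

Lemma covert_rate_lt : mu1 < 2 * mu2 -> rate n = expR (- (x / 2)).
Proof.
move=> h; rewrite /covert_scale h {2}natr_expR_ln {1}natr_expR_ln sqrt_expR -expRN -expRD.
by congr expR; lra.
Qed.

Lemma covert_rate_eq : mu1 = 2 * mu2 -> rate n = expR (- (x / 2)) / Num.sqrt x.
Proof.
move=> h; rewrite /covert_scale h ltxx eqxx sqrtrM ?ler0n// sqrtrV; last by rewrite (le_trans ler01).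
rewrite {3}natr_expR_ln {1}natr_expR_ln sqrt_expR mulrAC -expRN -expRD.
by congr (expR _ / _); lra.
Qed.

Lemma covert_rate_gt : 2 * mu2 < mu1 -> rate n = expR (- a * L).
Proof.
move=> h; rewrite /covert_scale ltNge (ltW h)/= gt_eqF//.
rewrite /powR gt_eqF ?natr_gt0_ln_ge1// {2}natr_expR_ln -expRN -expRD.
by congr expR; field; rewrite gt_eqF.
Qed.

End asymptotics.

End scales.

Section scale_upper.
Context {R : realType}.
Variables mu1 mu2 : R.
Hypotheses (mu1_gt0 : 0 < mu1) (mu2_gt0 : 0 < mu2).
Local Notation a := (mu1 - mu2).
Local Notation rate n := (covert_scale mu1 mu2 n / n%:R).
Local Notation L n := (ln n%:R / mu1).
Local Notation mass c y := (expR_primitive c y - expR_primitive c 0).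

(** The two terms of [affinity_ge] at the critical probability [b_n / n]: the
    second moment below the cutoff and the first moment above it are both
    [O(1 / n)]. *)
Lemma covert_rate_upper (b : R) : b < mu1 -> (mu1 < 2 * mu2 -> 2 * b < mu1) ->
  (2 * mu2 <= mu1 -> b = a) -> exists2 C : R, 0 <= C &
  forall n, 1 <= ln n%:R :> R ->
  [/\ 0 <= rate n,
    n%:R * rate n ^+ 2 * mass (2 * b - mu1) (L n) <= C &
    n%:R * rate n * expR ((b - mu1) * L n) <= C].
Proof.
move=> bmu1 b1 b2.
have m1 := mu1_gt0; have m2 := mu2_gt0; have m10 : mu1 != 0 by rewrite gt_eqF.
have [h|] := ltP mu1 (2 * mu2).
  have c0 : 0 < mu1 - 2 * b by have := b1 h; lra.
  exists ((mu1 - 2 * b)^-1 + 1); first by rewrite addr_ge0// invr_ge0 ltW.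
  move=> n n1; rewrite covert_rate_lt//; have nE := natr_expR_ln _ n1.
  have L0 : 0 <= L n by rewrite divr_ge0// ?ltW// (lt_le_trans ltr01).
  split; first exact: expR_ge0.
  - rewrite {1}nE -expRM_natl -expRD (_ : ln _ + _ = 0); last by lra.
    rewrite expR0 mul1r; apply: le_trans (expR_primitiveB_le_inv _ _ _) _; first by lra.
    by rewrite opprB lerDl.
  - rewrite {1}nE -!expRD (_ : _ + _ = (b - mu1 / 2) * L n); last by field.
    rewrite (@le_trans _ _ 1)//; last by rewrite lerDr invr_ge0 ltW.
    rewrite -[leRHS]expR0 ler_expR mulr_le0_ge0//. lra.
rewrite le_eqVlt => /orP[/eqP h|h].
  have bE : b = a by apply: b2; rewrite h.
  have bm : 2 * b - mu1 = 0 by rewrite bE -h; lra.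
  exists (mu1^-1 + 1); first by rewrite addr_ge0// invr_ge0 ltW.
  move=> n n1; rewrite covert_rate_eq//; have nE := natr_expR_ln _ n1.
  set x := ln n%:R in n1 nE *.
  have x0 : 0 < x by rewrite (lt_le_trans ltr01).
  have sx1 : 1 <= Num.sqrt x by rewrite -[leLHS]sqrtr1 ler_sqrt// ltW.
  split; first by rewrite divr_ge0 ?expR_ge0 ?sqrtr_ge0.
  - have ne2 : n%:R * expR (- (x / 2)) ^+ 2 = 1.
      by rewrite nE -expRM_natl -expRD -[RHS]expR0; congr expR; lra.
    rewrite bm /expR_primitive eqxx subr0 expr_div_n sqr_sqrtr; last exact: ltW.
    rewrite [n%:R * _]mulrA ne2.
    by rewrite mul1r mulrA mulVf ?gt_eqF// mul1r lerDl.
  - have -> : n%:R * (expR (- (x / 2)) / Num.sqrt x) * expR ((b - mu1) * (x / mu1)) =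
        n%:R * (expR (- (x / 2)) * expR ((b - mu1) * (x / mu1))) / Num.sqrt x by ring.
    rewrite {1}nE -!expRD (_ : _ + _ = 0); last first.
      rewrite bE (_ : mu2 = mu1 / 2); last by lra.
      by field.
    rewrite expR0 mul1r (@le_trans _ _ 1)//; last by rewrite lerDr invr_ge0 ltW.
    by rewrite invf_le1// (lt_le_trans ltr01).
have bE : b = a by apply: b2; rewrite ltW.
have c0 : 0 < 2 * b - mu1 by lra.
exists ((2 * b - mu1)^-1 + 1); first by rewrite addr_ge0// invr_ge0 ltW.
move=> n n1; rewrite covert_rate_gt//; have nE := natr_expR_ln _ n1.
split; first exact: expR_ge0.
- apply: (@le_trans _ _ (n%:R * expR (- a * L n) ^+ 2 * (expR ((2 * b - mu1) * L n) / (2 * b - mu1)))).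
    by apply: ler_wpM2l; rewrite ?mulr_ge0 ?sqr_ge0// expR_primitiveB_le_expR.
  rewrite {1}nE -expRM_natl -expRD mulrA -expRD (_ : _ + _ = 0) ?expR0 ?mul1r ?lerDl//.
  by rewrite bE; field.
- rewrite {1}nE -!expRD (_ : _ + _ = 0) ?expR0 ?lerDr ?invr_ge0 ?ltW//.
  by rewrite bE; field.
Qed.

End scale_upper.

Section scale_lower.
Context {R : realType}.
Variables lambda mu1 mu2 : R.
Hypotheses (lambda_gt0 : 0 < lambda) (mu1_gt0 : 0 < mu1) (mu2_gt0 : 0 < mu2).
Local Notation a := (mu1 - mu2).
Local Notation rate n := (covert_scale mu1 mu2 n / n%:R).
Local Notation L n := (ln n%:R / mu1).
Local Notation density := (iebp_density lambda mu1 mu2).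
Local Notation score := (delay_score mu1 mu2).
Let w : R := lambda * expR (- lambda) * mu1.

Let w_gt0 : 0 < w.
Proof. by rewrite /w !mulr_gt0// expR_gt0. Qed.

Let density0_ge y t : 0 <= y -> 0 <= t <= 1 -> w * expR (- mu1 * y) <= density 0 (y, t).
Proof.
move=> y0 /andP[t0 t1].
rewrite /iebp_density mul0r addr0 mulr1 !exponential_pdfE//= /w -mulrA.
apply: ler_wpM2r; first by rewrite mulr_ge0 ?expR_ge0// ltW.
apply: ler_wpM2l; first exact: ltW.
by rewrite ler_expR mulNr lerN2 ler_piMr// ltW.
Qed.

Let decay_ge t : 0 <= t <= 1 -> expR (- mu2) <= expR (- mu2 * t) <= 1.
Proof.
move=> /andP[t0 t1]; apply/andP; split.
  by rewrite ler_expR mulNr lerN2 ler_piMr// ltW.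
by rewrite -expR0 ler_expR mulNr oppr_le0 mulr_ge0// ltW.
Qed.

(** Near the origin the density of [sigma1 + sigma2] is small, so the score is
    negative there and bounded away from 0. *)
Let origin_ratio (y1 := (2 * mu2 * expR `|a| + 1)^-1) y : 0 <= y <= y1 ->
  delay_ratio mu1 mu2 y <= 2^-1.
Proof.
move=> /andP[y0 yy1].
have e0 : 0 < 2 * mu2 * expR `|a| by rewrite !mulr_gt0// expR_gt0.
have y11 : y1 <= 1 by rewrite invf_le1; lra.
apply: (@le_trans _ _ (mu2 * (y * expR `|a|))).
  apply: ler_wpM2l; first exact: ltW.
  by apply: expR_primitiveB_le; rewrite y0 (le_trans yy1).
have : y * (2 * mu2 * expR `|a| + 1) <= 1 by rewrite -ler_pdivlMr ?div1r//; lra.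
rewrite mulrCA -!mulrA; move: (mu2 * _) => k; lra.
Qed.

(** For [mu2 < mu1] the score grows like [expR (a * y)]: half of the main term
    absorbs the two subtracted constants once [y] is large. *)
Let tail_score : 0 < a -> exists2 y0 : R, 0 <= y0 & forall y t, y0 <= y -> 0 <= t <= 1 ->
  expR (- mu2) * (mu2 / (2 * a)) * expR (a * y) <= score (y, t).
Proof.
move=> a0; have k0 : 0 < mu2 / a by rewrite divr_gt0.
exists ((1 + mu2 / a) * 2 / mu2).
  by rewrite divr_ge0 ?mulr_ge0 ?addr_ge0// ltW.
move=> y t yy0 t01; have /andP[e0 e1] := decay_ge _ t01.
rewrite /delay_score /delay_ratio /= expR_primitiveB_neq0 ?gt_eqF//.
have kE : mu2 / (2 * a) = mu2 / a / 2 by field; rewrite gt_eqF.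
have h : mu2 / (2 * a) * expR (a * y) <= mu2 * ((expR (a * y) - 1) / a) - 1.
  have h1 : 1 + mu2 / a <= mu2 / a / 2 * expR (a * y).
    rewrite -ler_pdivrMl; last by rewrite divr_gt0.
    apply: (@le_trans _ _ (1 + a * y)); last exact: expR_ge1Dx.
    apply: (@le_trans _ _ (a * y)); last by rewrite lerDr.
    rewrite [leLHS](_ : _ = a * ((1 + mu2 / a) * 2 / mu2)); last first.
      by field; rewrite !gt_eqF.
    by rewrite ler_pM2l.
  rewrite kE (mulrC (expR _ - 1)) mulrA; move: (expR (a * y)) (mu2 / a) h1 => e k; lra.
rewrite -mulrA; apply: ler_pM => //.
by rewrite mulr_ge0 ?expR_ge0// divr_ge0 ?mulr_ge0// ltW.
Qed.

(** A strip of values of [y] on which the Hellinger integrand is at least [m], with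
    total contribution at least [c / n].  For [2 * mu2 <= mu1],
    [(sqrt (1 + q Z) - 1) ^ 2] is increasing in [q] on the strip, and for
    [mu1 < 2 * mu2] it is bounded below by a multiple of [q ^ 2]; so it suffices
    to know that [q] is at least critical. *)
Lemma covert_rate_lower : exists c T : R, [/\ 0 < c, 1 <= T &
  forall n q, T <= ln n%:R :> R -> rate n <= q -> q <= 1 ->
  exists y1 y2 m : R, [/\ 0 <= y1, y1 <= y2, 0 <= m,
    c <= n%:R * m * (y2 - y1) &
    forall y t, y1 <= y <= y2 -> 0 <= t <= 1 ->
      m <= density 0 (y, t) * (Num.sqrt (1 + q * score (y, t)) - 1) ^+ 2]].
Proof.
have m1 := mu1_gt0; have m2 := mu2_gt0; have m10 : mu1 != 0 by rewrite gt_eqF.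
have [h|h2] := ltP mu1 (2 * mu2).
  pose y1 : R := (2 * mu2 * expR `|a| + 1)^-1.
  have y1_gt0 : 0 < y1 by rewrite invr_gt0 addr_gt0// !mulr_gt0// expR_gt0.
  pose m0 : R := w * expR (- mu1 * y1) * (expR (- mu2) ^+ 2 / 16).
  have m0_gt0 : 0 < m0 by rewrite /m0 !mulr_gt0 ?expR_gt0 ?exprn_gt0 ?expR_gt0.
  exists (m0 * y1), 1; split => //; first by rewrite mulr_gt0.
  move=> n q n1 qn q1; have nE := natr_expR_ln _ n1; have n0 := natr_gt0_ln_ge1 _ n1.
  have r0 : 0 <= rate n by rewrite covert_rate_lt// expR_ge0.
  have rE : rate n ^+ 2 = n%:R^-1.
    rewrite covert_rate_lt// -expRM_natl {2}nE -expRN; congr expR; lra.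
  have q0 := le_trans r0 qn.
  exists 0, y1, (m0 / n%:R); split => //.
  - exact: ltW.
  - by rewrite divr_ge0// ltW.
  - by rewrite subr0 mulrCA mulfV ?mulr1 ?gt_eqF.
  - move=> y t y01 t01; have /andP[y0 yy1] := y01.
    have /andP[e0 e1] := decay_ge _ t01.
    have rr := origin_ratio _ y01; have r1 := delay_ratio_ge0 mu1 mu2 mu2_gt0 _ y0.
    have z1 : -1 <= score (y, t) by apply: delay_score_ge => //; case/andP: t01.
    have em := expR_gt0 (- mu2).
    have z2 : score (y, t) <= - (expR (- mu2) / 2).
      rewrite /delay_score /=; move: (delay_ratio _ _ _) (expR (- mu2 * t)) e0 e1 rr => r e *; nra.
    have qz1 : -1 <= q * score (y, t) by nra.
    have qz2 : q * score (y, t) <= 0 by nra.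
    have A : w * expR (- mu1 * y1) <= w * expR (- mu1 * y).
      by apply: ler_wpM2l; [exact: ltW|rewrite ler_expR !mulNr lerN2 ler_pM2l].
    have B : expR (- mu2) ^+ 2 / 16 / n%:R <= (q * score (y, t)) ^+ 2 / 4.
      have : rate n * (expR (- mu2) / 2) <= - (q * score (y, t)).
        rewrite -mulrN; apply: ler_pM => //.
        by rewrite lerNr.
      rewrite -ler_sqr ?nnegrE; last 2 first.
      - by rewrite mulr_ge0// divr_ge0// ltW.
      - by rewrite oppr_ge0.
      rewrite sqrrN exprMn rE expr_div_n => B.
      apply: (@le_trans _ _ (n%:R^-1 * (expR (- mu2) ^+ 2 / 2 ^+ 2) / 4)).
        by rewrite le_eqVlt; apply/orP; left; apply/eqP; field; rewrite gt_eqF.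
      by rewrite ler_pM2r.
    apply: le_trans (ler_pM _ _ (density0_ge _ _ y0 t01) (sqrt1D_sub1_ge_neg _ qz1 qz2)).
    + rewrite /m0 -mulrA; apply: ler_pM => //.
      * by rewrite mulr_ge0 ?expR_ge0// ltW.
    + by rewrite mulr_ge0 ?expR_ge0// ltW.
    + by rewrite divr_ge0 ?sqr_ge0.
have a0 : 0 < a by lra.
have [y0 y0_ge0 tail] := tail_score a0.
set k := expR (- mu2) * (mu2 / (2 * a)) in tail.
have k0 : 0 < k by rewrite mulr_gt0 ?expR_gt0 ?divr_gt0 ?mulr_gt0.
clearbody k.
move: h2; rewrite le_eqVlt => /orP[/eqP h|h].
  pose m0 : R := w * (k ^+ 2 / (2 + k) ^+ 2).
  have k2 : 0 < (2 + k) ^+ 2 by rewrite exprn_gt0// addr_gt0.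
  have m0_gt0 : 0 < m0 by rewrite mulr_gt0// divr_gt0// exprn_gt0.
  exists (m0 / (2 * mu1)), (1 + 2 * mu1 * y0); split.
  - by rewrite divr_gt0// mulr_gt0.
  - by rewrite lerDl !mulr_ge0// ltW.
  move=> n q nT qn q1.
  have n1 : 1 <= ln n%:R :> R by apply: le_trans nT; rewrite lerDl !mulr_ge0// ltW.
  have nE := natr_expR_ln _ n1; have n0 := natr_gt0_ln_ge1 _ n1.
  have mL := mulr_cutoff _ mu1_gt0 n.
  set x := ln n%:R in nT n1 nE mL *.
  have x0 : 0 < x by rewrite (lt_le_trans ltr01).
  have sx1 : 1 <= Num.sqrt x by rewrite -[leLHS]sqrtr1 ler_sqrt// ltW.
  have rE : rate n = expR (- (x / 2)) / Num.sqrt x by exact: covert_rate_eq.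
  have Ly0 : y0 <= x / mu1 / 2.
    rewrite -mulrA -invfM ler_pdivlMr ?mulr_gt0//; lra.
  exists (x / mu1 / 2), (x / mu1), (m0 / (n%:R * x)); split.
  - exact: le_trans Ly0.
  - by rewrite ler_pdivrMr// ler_peMr ?divr_ge0 ?ltW//; lra.
  - by apply: divr_ge0; [exact: ltW|rewrite mulr_ge0// ltW].
  - rewrite le_eqVlt; apply/orP; left; apply/eqP; field.
    by rewrite !gt_eqF.
  move=> y t /andP[yl yr] t01.
  have y_ge0 : 0 <= y by apply: le_trans yl; exact: le_trans Ly0.
  have z1 := tail y t (le_trans Ly0 yl) t01.
  pose x1 := rate n * (k * expR (a * y)).
  have r0 : 0 <= rate n by rewrite rE divr_ge0 ?expR_ge0 ?sqrtr_ge0.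
  have x1_ge0 : 0 <= x1.
    by apply: mulr_ge0 => //; apply: mulr_ge0; [exact: ltW|exact: expR_ge0].
  have x1q : x1 <= q * score (y, t).
    by apply: ler_pM => //; rewrite mulr_ge0 ?expR_ge0// ltW.
  have e2 : expR (a * y) <= expR (x / 2).
    rewrite ler_expR; apply: (@le_trans _ _ (a * (x / mu1))); first by rewrite ler_pM2l.
    by rewrite le_eqVlt; apply/orP; left; apply/eqP; rewrite (_ : mu2 = mu1 / 2); [field|lra].
  have x1k : x1 <= k.
    rewrite /x1 rE (_ : _ * (k * _) = k * (expR (- (x / 2)) * expR (a * y) / Num.sqrt x)); last by ring.
    apply: ler_piMr; first exact: ltW.
    rewrite ler_pdivrMr ?mul1r; last by rewrite (lt_le_trans ltr01).
    by rewrite (le_trans _ sx1)// expRN mulrC ler_pdivrMr ?expR_gt0// mul1r.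
  apply: le_trans (ler_pM _ _ (density0_ge _ _ y_ge0 t01) (sqrt1D_sub1_ge_pos _ _ _ x1_ge0 x1q x1k)).
  - have ne2 : n%:R * expR (- (x / 2)) ^+ 2 = 1.
      by rewrite nE -expRM_natl -expRD -[RHS]expR0; congr expR; lra.
    have nx : (n%:R * x)^-1 = rate n ^+ 2.
      rewrite rE expr_div_n sqr_sqrtr; last exact: ltW.
      have nn0 : n%:R != 0 :> R by rewrite gt_eqF.
      by rewrite invfM; congr (_ / _); apply: (mulfI nn0); rewrite ne2 mulfV.
    have e2y : expR (- mu1 * y) * expR (a * y) ^+ 2 = 1.
      by rewrite -expRM_natl -expRD -[RHS]expR0; congr expR; rewrite -h; ring.
    rewrite le_eqVlt; apply/orP; left; apply/eqP.
    rewrite nx /m0 /x1.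
    transitivity (w * (k ^+ 2 / (2 + k) ^+ 2) * rate n ^+ 2 *
        (expR (- mu1 * y) * expR (a * y) ^+ 2)); first by rewrite e2y mulr1.
    by move: (rate n) ((2 + k) ^+ 2)^-1 => r i; ring.
  - by rewrite mulr_ge0 ?expR_ge0// ltW.
  - by rewrite divr_ge0 ?sqr_ge0.
pose K := k * expR (- a).
have K0 : 0 < K by rewrite mulr_gt0 ?expR_gt0.
pose m0 : R := w * (K ^+ 2 / (2 + K) ^+ 2).
have k2 : 0 < (2 + K) ^+ 2 by rewrite exprn_gt0// addr_gt0.
have m0_gt0 : 0 < m0 by rewrite mulr_gt0// divr_gt0// exprn_gt0.
exists m0, (1 + mu1 * (y0 + 1)); split => //.
- by rewrite lerDl mulr_ge0 ?addr_ge0// ltW.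
move=> n q nT qn q1.
have n1 : 1 <= ln n%:R :> R by apply: le_trans nT; rewrite lerDl mulr_ge0 ?addr_ge0// ltW.
have nE := natr_expR_ln _ n1; have n0 := natr_gt0_ln_ge1 _ n1.
have mL := mulr_cutoff _ mu1_gt0 n.
have rE : rate n = expR (- a * L n) by exact: covert_rate_gt.
have Ly0 : y0 <= L n - 1 by rewrite lerBrDr ler_pdivlMr//; lra.
exists (L n - 1), (L n), (m0 / n%:R); split.
- exact: le_trans Ly0.
- by rewrite gerBl.
- by rewrite divr_ge0// ltW.
- by rewrite subKr mulr1 mulrCA mulfV ?mulr1// gt_eqF.
move=> y t /andP[yl yr] t01.
have y_ge0 : 0 <= y by apply: le_trans yl; exact: le_trans Ly0.
have z1 := tail y t (le_trans Ly0 yl) t01.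
have r0 : 0 <= rate n by rewrite rE expR_ge0.
have Kq : K <= q * score (y, t).
  apply: (@le_trans _ _ (rate n * (k * expR (a * (L n - 1))))).
    rewrite rE /K mulrCA -expRD le_eqVlt; apply/orP; left; apply/eqP.
    by congr (_ * expR _); ring.
  apply: ler_pM => //; first by rewrite mulr_ge0 ?expR_ge0// ltW.
  apply: le_trans z1; apply: ler_wpM2l; first exact: ltW.
  by rewrite ler_expR ler_pM2l.
apply: le_trans (ler_pM _ _ (density0_ge _ _ y_ge0 t01) (sqrt1D_sub1_ge_pos _ _ _ (ltW K0) Kq (lexx K))).
- rewrite /m0 mulrAC; apply: ler_wpM2r; first by rewrite divr_ge0 ?sqr_ge0.
  apply: ler_wpM2l; first exact: ltW.
  by rewrite nE -expRN ler_expR mulNr lerN2 -mL ler_pM2l.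
- by rewrite mulr_ge0 ?expR_ge0// ltW.
- by rewrite divr_ge0 ?sqr_ge0.
Qed.

End scale_lower.

(** * Covertness *)

Section limsup.
Context {R : realType}.
Local Open Scope ereal_scope.

Lemma limn_esup_le (u : (\bar R)^nat) (l : \bar R) :
  (\forall n \near \oo, u n <= l) -> limn_esup u <= l.
Proof.
move=> ul; apply: (@le_trans _ _ (ereal_sup (u @` [set n | u n <= l]))).
  by apply: ereal_inf_lbound; exists [set n | u n <= l].
by apply: ge_ereal_sup => _ [n /= h <-].
Qed.

Lemma limn_esup_ge (u : (\bar R)^nat) (l : \bar R) :
  (\forall n \near \oo, l <= u n) -> l <= limn_esup u.
Proof.
move=> ul; apply: le_ereal_inf_tmp => _ [V FV <-].
have [n [Vn lun]] : exists n, V n /\ l <= u n.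
  by apply: (@filter_ex _ \oo); exact: filterI.
by apply: (le_trans lun); apply: ereal_sup_ubound; exists n.
Qed.
End limsup.

Lemma bernoulli_le {R : realDomainType} (r : R) n : 0 <= r <= 1 ->
  1 - r ^+ n <= n%:R * (1 - r).
Proof.
move=> /andP[r0 r1]; elim: n => [|n IH]; first by rewrite expr0 subrr mul0r.
have rn : 0 <= 1 - r ^+ n by rewrite subr_ge0 exprn_ile1.
have -> : 1 - r ^+ n.+1 = (1 - r ^+ n) * r + (1 - r) by rewrite exprSr; ring.
by rewrite -natr1 [leRHS]mulrDl mul1r lerD2r (le_trans _ IH)// ler_piMr.
Qed.

Lemma near_ln_ge {R : realType} (T : R) : \forall n \near \oo, T <= ln n%:R :> R.
Proof.
near=> n.
have n0 : expR T <= n%:R by near: n; exact: nbhs_infty_ger.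
rewrite -ler_expR lnK// posrE (lt_le_trans _ n0)// expR_gt0.
Unshelve. all: by end_near. Qed.

Lemma covert_scale_ge0 {R : realType} (mu1 mu2 : R) n : 0 <= covert_scale mu1 mu2 n.
Proof.
rewrite /covert_scale; case: ifP => _; first exact: sqrtr_ge0.
by case: ifP => _; [exact: sqrtr_ge0|exact: powR_ge0].
Qed.

Lemma leb2_rectangle {R : realType} (y1 y2 t1 t2 : R) : y1 <= y2 -> t1 <= t2 ->
  leb2 (`[y1, y2]%classic `*` `[t1, t2]%classic : set (R * R)) = ((y2 - y1) * (t2 - t1))%:E.
Proof.
have itvE (u v : R) : u <= v -> lebR `[u, v]%classic = (v - u)%:E.
  move=> uv; transitivity (lebesgue_measure [set` `[u, v]]) => //.
  rewrite lebesgue_measure_itv/= lte_fin.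
  by move: uv; rewrite le_eqVlt => /orP[/eqP->|->]; rewrite ?ltxx ?subrr ?EFinB.
move=> y12 t12.
have [mI mJ] : measurable (`[y1, y2]%classic : set R) /\ measurable (`[t1, t2]%classic : set R).
  by split; exact: measurable_itv.
rewrite leb2_product; last exact: measurableX.
rewrite product_measure1E// EFinM.
by congr (_ * _)%E; exact: itvE.
Qed.

Section covertness.
Context {R : realType}.
Variables (lambda mu1 mu2 : R) (f : R -> R * R -> R).
Hypotheses (lambda_gt0 : 0 < lambda) (mu1_gt0 : 0 < mu1) (mu2_gt0 : 0 < mu2).
Local Notation rate n := (covert_scale mu1 mu2 n / n%:R).
Hypothesis fP : forall q, 0 <= q <= 1 ->
  [/\ measurable_fun setT (f q), forall x, 0 <= f q x,
      (\int[leb2]_x (f q x)%:E = 1)%E &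
      ae_eq leb2 setT (EFin \o f q) (EFin \o iebp_density lambda mu1 mu2 q)].

Let zero01 : 0 <= (0 : R) <= 1. Proof. by rewrite lexx ler01. Qed.

(** The hypothesis on [phi] reads [1 / phi n <= C0 * b_n / n], hence
    [delta / phi n <= k * b_n / n] with [k] as small as desired.  Taking
    [c = eps / 2] in [TV_tensor_le] leaves the requirement [k * M <= eps ^ 2]. *)
Lemma can_be_covert_iebp : can_be_covert f (covert_scale mu1 mu2).
Proof.
move=> phi phi1 /eqO_exP[C0 C0_gt0 phiO] eps eps_gt0.
have [K [b [K0 bmu1 grow b1 b2]]] := delay_ratio_growth mu1 mu2 mu1_gt0 mu2_gt0.
have [C C_ge0 upper] := covert_rate_upper _ _ mu1_gt0 mu2_gt0 _ bmu1 b1 b2.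
have gap : 0 < mu1 - b by rewrite subr_gt0.
pose M := K ^+ 2 * mu1 * C + K * mu1 * C / (mu1 - b).
have M_ge0 : 0 <= M.
  by rewrite addr_ge0 ?divr_ge0 ?mulr_ge0 ?sqr_ge0// ltW.
pose k : R := Num.min 1 (eps ^+ 2 / (M + 1)).
have k_gt0 : 0 < k.
  by rewrite lt_min ltr01 divr_gt0 ?exprn_gt0// ltr_wpDl.
pose delta : R := Num.min 1 (k / C0).
have d_gt0 : 0 < delta by rewrite lt_min ltr01 divr_gt0.
have d_le1 : delta <= 1 by rewrite ge_min lexx.
exists delta; first by rewrite d_gt0.
apply: limn_esup_le; near=> n.
have n1 : 1 <= ln n%:R :> R by near: n; exact: near_ln_ge.
have n0 := natr_gt0_ln_ge1 _ n1.
have phin1 : 1 <= phi n by apply: phi1; rewrite -(ltr0n R).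
have phi0 : 0 < phi n by apply: lt_le_trans phin1.
have [rate_ge0 U1 U2] := upper n n1.
set q := delta / phi n.
have q01 : 0 <= q <= 1.
  rewrite divr_ge0 ?(ltW d_gt0) ?(ltW phi0)//= ler_pdivrMr// mul1r.
  exact: le_trans phin1.
have b_ge0 : 0 <= covert_scale mu1 mu2 n.
  by move: rate_ge0; rewrite pmulr_lge0// invr_gt0.
have qk : q <= k * rate n.
  have : `|n%:R / phi n| <= C0 * `|covert_scale mu1 mu2 n| by near: n.
  rewrite !ger0_norm ?divr_ge0 ?(ltW phi0) ?(ltW n0)// => phin.
  have phiV : (phi n)^-1 <= C0 * rate n.
    by rewrite mulrA ler_pdivlMr// mulrC.
  apply: (@le_trans _ _ (k / C0 * (C0 * rate n))).
    apply: ler_pM => //; rewrite ?invr_ge0 ?(ltW d_gt0) ?(ltW phi0)//.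
    by rewrite ge_min lexx orbT.
  by rewrite [k / C0 * _]mulrA divfK ?gt_eqF.
have [mf0 f0_ge0 If0 f0E] := fP 0 zero01.
have [mf1 f1_ge0 If1 f1E] := fP q q01.
have [rho rho01 Irho] := affinity_ex _ _ mf0 mf1 f0_ge0 f1_ge0 If0 If1.
have L_ge0 : 0 <= ln n%:R / mu1 by rewrite divr_ge0 ?(ltW mu1_gt0)// (le_trans ler01).
have := affinity_ge _ _ _ lambda_gt0 mu1_gt0 mu2_gt0 _ _ _ q01 mf0 mf1 f0_ge0 f1_ge0 If0 If1
  f0E f1E _ Irho K b _ bmu1 L_ge0 K0 grow.
have E_ge0 := expR_primitiveB_ge0 (2 * b - mu1) _ L_ge0.
have X_ge0 := expR_ge0 ((b - mu1) * (ln n%:R / mu1)).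
move: (expR_primitive _ _ - _) (expR _) E_ge0 X_ge0 U1 U2 => E X E_ge0 X_ge0 U1 U2 H.
have k_le1 : k <= 1 by rewrite ge_min lexx.
have q_ge0 : 0 <= q by case/andP: q01.
have q2 : q ^+ 2 <= k * rate n ^+ 2.
  apply: (@le_trans _ _ ((k * rate n) ^+ 2)).
    by rewrite ler_sqr ?nnegrE// mulr_ge0// ltW.
  rewrite exprMn; apply: ler_wpM2r; first exact: sqr_ge0.
  by rewrite expr2 ler_piMl// ltW.
have nH : n%:R * (2 * (1 - rho)) <= k * M.
  apply: (@le_trans _ _ (n%:R * (q ^+ 2 * K ^+ 2 * mu1 * E + q * K * mu1 * (X / (mu1 - b))))).
    by apply: ler_wpM2l; [exact: ltW|lra].
  have T1 : n%:R * (q ^+ 2 * K ^+ 2 * mu1 * E) <= k * (K ^+ 2 * mu1 * C).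
    apply: (@le_trans _ _ (K ^+ 2 * mu1 * (k * (n%:R * rate n ^+ 2 * E)))); last first.
      rewrite [leRHS]mulrCA; apply: ler_wpM2l; first by rewrite mulr_ge0 ?sqr_ge0// ltW.
      by apply: ler_wpM2l => //; exact: ltW.
    rewrite (_ : n%:R * _ = K ^+ 2 * mu1 * (n%:R * E * q ^+ 2)); last by ring.
    rewrite (_ : k * _ = n%:R * E * (k * rate n ^+ 2)); last by ring.
    apply: ler_wpM2l; first by rewrite mulr_ge0 ?sqr_ge0// ltW.
    by apply: ler_wpM2l => //; rewrite mulr_ge0// ltW.
  have T2 : n%:R * (q * K * mu1 * (X / (mu1 - b))) <= k * (K * mu1 * C / (mu1 - b)).
    apply: (@le_trans _ _ (K * mu1 / (mu1 - b) * (k * (n%:R * rate n * X)))); last first.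
      rewrite (_ : k * (K * mu1 * C / _) = K * mu1 / (mu1 - b) * (k * C)); last by ring.
      apply: ler_wpM2l; first by rewrite divr_ge0 ?mulr_ge0// ltW.
      by apply: ler_wpM2l => //; exact: ltW.
    rewrite (_ : n%:R * _ = K * mu1 / (mu1 - b) * (n%:R * X * q)); last by ring.
    rewrite (_ : k * _ = n%:R * X * (k * rate n)); last by ring.
    apply: ler_wpM2l; first by rewrite divr_ge0 ?mulr_ge0// ltW.
    by apply: ler_wpM2l => //; rewrite mulr_ge0// ltW.
  by rewrite /M !mulrDr; exact: lerD.
have kM : k * M <= eps ^+ 2.
  apply: (@le_trans _ _ (k * (M + 1))); first by apply: ler_wpM2l; [exact: ltW|rewrite lerDl].
  by rewrite -ler_pdivlMr ?ltr_wpDl// ge_min lexx orbT.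
have bern := bernoulli_le _ n rho01.
have e2 : 0 < eps / 2 by rewrite divr_gt0.
rewrite /TV_iebp -leb2E.
apply: le_trans (TV_tensor_le leb2 _ _ _ mf0 mf1 f0_ge0 f1_ge0 If0 If1 Irho n _ e2) _.
rewrite lee_fin -ler_pdivlMl ?invr_gt0// invrK.
have : (1 - rho ^+ n) / (eps / 2) <= eps.
  by rewrite ler_pdivrMr// mulrA -expr2 ler_pdivlMr//; lra.
lra.
Unshelve. all: by end_near. Qed.

(** Eventually [q n >= b_n / n], so [rho <= 1 - c / (2 n)] and
    [rho ^ n <= expR (- (c / 2))] stays away from 1. *)
Lemma cannot_be_covert_iebp : cannot_be_covert f (covert_scale mu1 mu2).
Proof.
have [c [T [c_gt0 T1 lower]]] := covert_rate_lower lambda mu1 mu2 lambda_gt0 mu1_gt0 mu2_gt0.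
have e1 : expR (- (c / 2)) < 1 by rewrite expR_lt1 oppr_lt0 divr_gt0.
exists ((1 - expR (- (c / 2))) / 2); first by rewrite divr_gt0// subr_gt0.
move=> q q01 q0 qoo.
apply: (@lt_le_trans _ _ (1 - expR (- (c / 2)))%:E).
  by rewrite lte_fin; lra.
apply: limn_esup_ge; near=> n.
have nT : T <= ln n%:R :> R by near: n; exact: near_ln_ge.
have n1 := le_trans T1 nT; have n0 := natr_gt0_ln_ge1 _ n1.
have rq : rate n <= q n.
  have : 1 <= n%:R * q n / covert_scale mu1 mu2 n.
    by near: n; move/cvgryPge : qoo; exact.
  have := covert_scale_ge0 mu1 mu2 n.
  rewrite le_eqVlt => /orP[/eqP<-|b0]; first by rewrite invr0 mulr0 ler10.
  by rewrite ler_pdivlMr// mul1r ler_pdivrMr// mulrC.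
have qn01 : 0 <= q n <= 1 by apply: q01; rewrite -(ltr0n R).
have [y1 [y2 [m [y1_ge0 y12 m_ge0 cm Hm]]]] := lower n (q n) nT rq (proj2 (andP qn01)).
have [mf0 f0_ge0 If0 f0E] := fP 0 zero01.
have [mf1 f1_ge0 If1 f1E] := fP _ qn01.
have [rho rho01 Irho] := affinity_ex _ _ mf0 mf1 f0_ge0 f1_ge0 If0 If1.
have mA : measurable (`[y1, y2]%classic `*` `[0, 1]%classic : set (R * R)).
  by apply: measurableX; exact: measurable_itv.
have rho_le : 2 * rho + m * (y2 - y1) <= 2.
  rewrite -lee_fin [leLHS]EFinD [X in (_ + X)%E]EFinM.
  have -> : (y2 - y1)%:E = leb2 (`[y1, y2]%classic `*` `[0, 1]%classic : set (R * R)).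
    by rewrite leb2_rectangle// subr0 mulr1.
  apply: (affinity_le _ _ _ lambda_gt0 mu1_gt0 mu2_gt0 _ _ _ qn01 mf0 mf1 f0_ge0 f1_ge0 If0 If1
    f0E f1E _ Irho _ _ mA m_ge0) => -[y t] /= [].
  by rewrite !in_itv/= => y12' t01; exact: Hm.
rewrite /TV_iebp -leb2E.
apply: le_trans (TV_tensor_ge leb2 _ _ _ mf0 mf1 f0_ge0 f1_ge0 If0 If1 Irho n).
rewrite lee_fin lerD2l lerN2.
have rho_exp : rho <= expR (- (c / 2) / n%:R).
  apply: le_trans (expR_ge1Dx _).
  have : c / n%:R <= m * (y2 - y1) by rewrite ler_pdivrMr// mulrC mulrA.
  rewrite mulNr mulrAC; lra.
apply: (@le_trans _ _ (expR (- (c / 2) / n%:R) ^+ n)).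
  by case/andP: rho01 => *; rewrite lerXn2r// ?nnegrE ?expR_ge0.
by rewrite -expRM_natl mulrCA mulfV ?mulr1// gt_eqF.
Unshelve. all: by end_near. Qed.
End covertness.

Theorem proposition5p4 (R : realType) (lambda mu1 mu2 : R)
    (d : measure_display) (Omega : measurableType d)
    (tau s1 s2 : nat -> {mfun Omega >-> R})
    (b : nat -> {mfun Omega >-> bool})
    (P : R -> probability Omega R) (f : R -> R * R -> R) :
  0 < lambda -> 0 < mu1 -> 0 < mu2 -> lambda / mu1 < 1 ->
  (forall q : R, 0 <= q <= 1 -> iebp_model (P q) tau s1 s2 b lambda mu1 mu2 q) ->
  (forall q : R, 0 <= q <= 1 ->
     forall j, has_density (P q) lebesgue2 (iebp_observation tau s1 s2 b j) (f q)) ->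
  can_be_covert f (covert_scale mu1 mu2) /\
  cannot_be_covert f (covert_scale mu1 mu2).
Proof.
move=> lambda_gt0 mu1_gt0 mu2_gt0 _ model fE.
have fP q : 0 <= q <= 1 ->
  [/\ measurable_fun setT (f q), forall x, 0 <= f q x,
      (\int[leb2]_x (f q x)%:E = 1)%E &
      ae_eq leb2 setT (EFin \o f q) (EFin \o iebp_density lambda mu1 mu2 q)].
  move=> q01; have f0 := fE q q01 0%N; have [mf f_ge0 _] := f0.
  split => //; first exact: integral_density_one f0.
  exact: (density_aeE _ _ _ lambda_gt0 mu1_gt0 mu2_gt0 _ _ _ _ _ _ _ q01 (model q q01) f0).
split; [exact: can_be_covert_iebp fP|exact: cannot_be_covert_iebp fP].
Qed.
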